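(* Let $E_{222}$ be the elliptic curve over the function field $\mathbb{Q}(a)$ given by \[ y^2 = x^3 + \left(16a + \tfrac{942}{13}\right)x^2 + \left(\tfrac{10048}{13}a + \tfrac{293084}{169}\right)x + 1024a^2 + \tfrac{1620800}{169}a + \tfrac{30250696}{2197}. \] Then $E_{222}(\mathbb{Q}(a))$ has rank $2$ and is generated by the two independent points $P(a) = \left(-\tfrac{262}{13},\, 32a+8\right)$ and $Q(a) = \left(-\tfrac{366}{13},\, 32a+8\right)$.
   Context: $E_{222}$ is a Weierstrass model of the genus-one curve $V(z_2^2 + z_1 z_3 - z_0^2 - a z_3^2,\, z_2^2 + z_2 z_3 - z_1^2 - a z_3^2) \subset \mathbb{P}^3_{\mathbb{Q}(a)}$, which parametrizes (for $f_c(x) = x^2+c$) third pre-images of $a$; its discriminant is $(4a+1)^2(256a^3+368a^2+104a+23)$. *)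

(* Defs.v *)
From HB Require Import structures.
From mathcomp Require Import all_boot all_order all_algebra fraction ring.

Set Implicit Arguments.
Unset Strict Implicit.
Unset Printing Implicit Defensive.

Import GRing.Theory.
Local Open Scope ring_scope.

Section ZRank.
Variable G : zmodType.

Definition z_independent (n : nat) (v : n.-tuple G) : Prop :=
  forall c : 'I_n -> int,
    \sum_(i < n) tnth v i *~ c i = 0 -> forall i, c i = 0.

Definition z_generates (n : nat) (v : n.-tuple G) : Prop :=
  forall g : G, exists c : 'I_n -> int, g = \sum_(i < n) tnth v i *~ c i.

(* r is the largest size of a Z-independent family, i.e. dim_Q (G (x) Q) = r. *)
Definition has_z_rank (r : nat) : Prop :=
  (exists v : r.-tuple G, z_independent v) /\
  (forall (n : nat) (v : n.-tuple G), z_independent v -> (n <= r)%N).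

End ZRank.

(* The discriminant 16 * disc (x^3 + a2 x^2 + a4 x + a6) of the Weierstrass
   equation y^2 = x^3 + a2 x^2 + a4 x + a6.  It vanishes in characteristic 2,
   where no equation of this shape is nonsingular. *)
Definition weierstrass_disc (K : fieldType) (a2 a4 a6 : K) : K :=
  16 * (a2 ^+ 2 * a4 ^+ 2 - 4 * a4 ^+ 3 - 4 * a2 ^+ 3 * a6
        + 18 * a2 * a4 * a6 - 27 * a6 ^+ 2).

Record ellcurve (K : fieldType) := EllCurve {
  ec_a2 : K;
  ec_a4 : K;
  ec_a6 : K;
  ec_disc_neq0 : weierstrass_disc ec_a2 ec_a4 ec_a6 != 0
}.

Section Points.
Variables (K : fieldType) (E : ellcurve K).
Local Notation a2 := (ec_a2 E).
Local Notation a4 := (ec_a4 E).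
Local Notation a6 := (ec_a6 E).

Definition cubic (x : K) : K := x ^+ 3 + a2 * x ^+ 2 + a4 * x + a6.

(* None is the point at infinity, Some (x, y) an affine point. *)
Definition on_curve (p : option (K * K)) : bool :=
  if p is Some (x, y) then y ^+ 2 == cubic x else true.

Record ecpoint := EcPoint { ecval :> option (K * K); _ : on_curve ecval }.

HB.instance Definition _ := [isSub for ecval].
HB.instance Definition _ := [Choice of ecpoint by <:].

Definition ec_neg_val (p : option (K * K)) : option (K * K) :=
  if p is Some (x, y) then Some (x, - y) else None.

(* The line of slope l through the affine point (x1, y1) meets the curve in
   three points whose abscissas sum to l^2 - a2; the sum of (x1, y1) and
   (x2, y2) is the reflection of the third one. *)
Definition third_val (l x1 y1 x2 : K) : option (K * K) :=
  let x3 := l ^+ 2 - a2 - x1 - x2 in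
  Some (x3, l * (x1 - x3) - y1).

Definition ec_add_val (p q : option (K * K)) : option (K * K) :=
  match p, q with
  | None, _ => q
  | _, None => p
  | Some (x1, y1), Some (x2, y2) =>
      if x1 != x2 then third_val ((y2 - y1) / (x2 - x1)) x1 y1 x2
      else if y1 == - y2 then None
      else third_val ((3 * x1 ^+ 2 + 2 * a2 * x1 + a4) / (2 * y1)) x1 y1 x2
  end.

Arguments ec_add_val : simpl never.

(* secant l m x1 x2 x3 : the line y = l x + m cuts the curve in points of
   abscissas x1, x2, x3 with multiplicity, that is
   cubic X - (l X + m)^2 = (X - x1) (X - x2) (X - x3). *)
Definition secant (l m x1 x2 x3 : K) : Prop :=
  [/\ x1 + x2 + x3 = l ^+ 2 - a2,
      x1 * x2 + x1 * x3 + x2 * x3 = a4 - 2 * l * m &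
      x1 * x2 * x3 = m ^+ 2 - a6].

Lemma ec_two_neq0 : (2 : K) != 0.
Proof.
apply/eqP => h; have /eqP[] := ec_disc_neq0 E.
rewrite /weierstrass_disc (_ : 16 = 2 * 8); last by ring.
by rewrite h !mul0r.
Qed.

Lemma ec_nonsingular x :
  cubic x = 0 -> 3 * x ^+ 2 + 2 * a2 * x + a4 = 0 -> False.
Proof.
rewrite /cubic => h1 h2; have /eqP[] := ec_disc_neq0 E.
have e4 : a4 = - (3 * x ^+ 2 + 2 * a2 * x).
  by rewrite -[RHS]addr0 -h2; ring.
have e6 : a6 = - (x ^+ 3 + a2 * x ^+ 2 + a4 * x).
  by rewrite -[RHS]addr0 -h1; ring.
by rewrite /weierstrass_disc e6 e4; ring.
Qed.

Lemma secant_on l m x1 x2 x3 :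
  secant l m x1 x2 x3 -> (l * x1 + m) ^+ 2 = cubic x1.
Proof.
case=> h1 h2 h3; rewrite /cubic.
have -> : a2 = l ^+ 2 - (x1 + x2 + x3) by rewrite h1; ring.
have -> : a4 = x1 * x2 + x1 * x3 + x2 * x3 + 2 * l * m by rewrite h2; ring.
have -> : a6 = m ^+ 2 - x1 * x2 * x3 by rewrite h3; ring.
ring.
Qed.

Lemma secantC l m x1 x2 x3 : secant l m x1 x2 x3 -> secant l m x2 x1 x3.
Proof. by case=> h1 h2 h3; split; rewrite -?h1 -?h2 -?h3; ring. Qed.

Lemma secantR l m x1 x2 x3 : secant l m x1 x2 x3 -> secant l m x2 x3 x1.
Proof. by case=> h1 h2 h3; split; rewrite -?h1 -?h2 -?h3; ring. Qed.

(* Secants and tangents at once, in a form symmetric in the three points. *)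
Lemma ec_add_secant x1 y1 x2 y2 :
    y1 ^+ 2 = cubic x1 -> y2 ^+ 2 = cubic x2 ->
    ~ (x1 = x2 /\ y1 = - y2) ->
  exists l m x3,
    [/\ secant l m x1 x2 x3, y1 = l * x1 + m, y2 = l * x2 + m
      & ec_add_val (Some (x1, y1)) (Some (x2, y2)) = Some (x3, - (l * x3 + m))].
Proof.
move=> c1 c2 hopp; rewrite /ec_add_val /third_val.
case: (eqVneq x1 x2) => [ex|nx] /=.
- have [ey|ny] := eqVneq y1 (- y2); first by case: hopp.
  have ey : y1 = y2.
    apply/eqP; move: c1; rewrite ex -c2 => /eqP; rewrite eqf_sqr.
    by rewrite (negbTE ny) orbF.
  subst x2 y2.
  have n0 : y1 != 0 by apply: contra_neq ny => ->; rewrite oppr0.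
  have n2 := ec_two_neq0.
  set l := _ / _.
  have hl : 2 * y1 * l = 3 * x1 ^+ 2 + 2 * a2 * x1 + a4.
    by rewrite /l; field; rewrite n2 n0.
  exists l, (y1 - l * x1), (l ^+ 2 - a2 - x1 - x1); split; try by ring.
  - have e4 : a4 = 2 * y1 * l - (3 * x1 ^+ 2 + 2 * a2 * x1) by rewrite hl; ring.
    have e6 : a6 = y1 ^+ 2 - (x1 ^+ 3 + a2 * x1 ^+ 2 + a4 * x1).
      by rewrite c1 /cubic; ring.
    by split; rewrite ?e6 ?e4; ring.
  - by congr (Some (_, _)); ring.
- have n12 : x2 - x1 != 0 by rewrite subr_eq0 eq_sym.
  set l := _ / _.
  have hl : y2 = y1 + l * (x2 - x1) by rewrite /l; field.
  exists l, (y1 - l * x1), (l ^+ 2 - a2 - x1 - x2).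
  have e6 : a6 = y1 ^+ 2 - (x1 ^+ 3 + a2 * x1 ^+ 2 + a4 * x1).
    by rewrite c1 /cubic; ring.
  have e4 : a4 = l * (y1 + y2) - (x1 ^+ 2 + x1 * x2 + x2 ^+ 2 + a2 * (x1 + x2)).
    apply: (mulIf n12); rewrite mulrBl.
    have -> : l * (y1 + y2) * (x2 - x1) = cubic x2 - cubic x1.
      by rewrite -c1 -c2 hl; ring.
    by rewrite /cubic; ring.
  split; try by [ring | rewrite hl; ring].
  - by split; rewrite ?e6 ?e4 ?hl; ring.
  - by congr (Some (_, _)); ring.
Qed.

(* A secant line is determined by two of its (non opposite) points. *)
Lemma secant_add l m x1 x2 x3 :
    secant l m x1 x2 x3 -> ~ (x1 = x2 /\ l * x1 + m = - (l * x2 + m)) ->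
  ec_add_val (Some (x1, l * x1 + m)) (Some (x2, l * x2 + m))
    = Some (x3, - (l * x3 + m)).
Proof.
move=> s hopp; have s' := secantC s.
have [l' [m' [x3' [[t1 t2 t3] e1 e2 ->]]]] :=
  ec_add_secant (secant_on s) (secant_on s') hopp.
case: s => s1 s2 s3.
have el : l' = l.
  have [ex|nx] := eqVneq x1 x2.
  - have /eqP hy : l * x1 + m <> 0.
      by move=> h; apply: hopp; rewrite -ex h oppr0.
    have n2 := ec_two_neq0.
    apply: (mulfI (mulf_neq0 n2 hy)).
    rewrite [in LHS]e1.
    have -> : 2 * (l * x1 + m) * l = 3 * x1 ^+ 2 + 2 * a2 * x1 + a4.
      have -> : a2 = l ^+ 2 - (x1 + x2 + x3) by rewrite s1; ring.
      have -> : a4 = x1 * x2 + x1 * x3 + x2 * x3 + 2 * l * m by rewrite s2; ring.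
      by rewrite -ex; ring.
    have -> : a2 = l' ^+ 2 - (x1 + x2 + x3') by rewrite t1; ring.
    have -> : a4 = x1 * x2 + x1 * x3' + x2 * x3' + 2 * l' * m' by rewrite t2; ring.
    by rewrite -ex; ring.
  - have n12 : x1 - x2 != 0 by rewrite subr_eq0.
    apply: (mulIf n12).
    transitivity ((l' * x1 + m') - (l' * x2 + m')); first by ring.
    by rewrite -e1 -e2; ring.
have em : m' = m.
  by apply: (addrI (l' * x1)); rewrite -e1 el.
rewrite el em in t1 *.
have -> : x3' = x3; last by [].
by apply: (addrI (x1 + x2)); rewrite t1 s1.
Qed.

Lemma secantN l m x1 x2 x3 :
  secant l m x1 x2 x3 -> secant (- l) (- m) x1 x2 x3.
Proof. by case=> h1 h2 h3; split; rewrite ?h1 ?h2 ?h3; ring. Qed.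

Lemma secant_simple l m x1 x2 : secant l m x1 x2 x1 -> l * x1 + m != 0.
Proof.
move=> s; apply/eqP=> h; apply: (@ec_nonsingular x1).
  by rewrite -(secant_on s) h expr0n.
case: s => h1 h2 _.
have -> : a2 = l ^+ 2 - (x1 + x2 + x1) by rewrite h1; ring.
have -> : a4 = x1 * x2 + x1 * x1 + x2 * x1 + 2 * l * m by rewrite h2; ring.
transitivity (2 * l * (l * x1 + m)); first by ring.
by rewrite h mulr0.
Qed.

Lemma ec_add_opp x y : ec_add_val (Some (x, y)) (Some (x, - y)) = None.
Proof. by rewrite /ec_add_val eqxx opprK eqxx. Qed.

Lemma on_curveE x y : on_curve (Some (x, y)) -> y ^+ 2 = cubic x.
Proof. by move/eqP. Qed.

Variant add_spec x1 y1 x2 y2 : option (K * K) -> Prop :=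
  | AddOpp of x1 = x2 & y1 = - y2 : add_spec x1 y1 x2 y2 None
  | AddSecant l m x3 of ~ (x1 = x2 /\ y1 = - y2) & secant l m x1 x2 x3
      & y1 = l * x1 + m & y2 = l * x2 + m :
      add_spec x1 y1 x2 y2 (Some (x3, - (l * x3 + m))).

Lemma ec_addP x1 y1 x2 y2 :
    on_curve (Some (x1, y1)) -> on_curve (Some (x2, y2)) ->
  add_spec x1 y1 x2 y2 (ec_add_val (Some (x1, y1)) (Some (x2, y2))).
Proof.
move=> c1 c2; case: (boolP ((x1 == x2) && (y1 == - y2))) => [/andP[]|/andP h].
  move=> /eqP ex /eqP ey.
  suff -> : ec_add_val (Some (x1, y1)) (Some (x2, y2)) = None by exact: AddOpp.
  by rewrite -[y2]opprK -ey ex ec_add_opp.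
have hopp : ~ (x1 = x2 /\ y1 = - y2).
  by case=> ex ey; apply: h; rewrite ex ey !eqxx.
have [l [m [x3 [s e1 e2 ->]]]] :=
  ec_add_secant (on_curveE c1) (on_curveE c2) hopp.
exact: AddSecant.
Qed.

Lemma on_curve_neg p : on_curve p -> on_curve (ec_neg_val p).
Proof. by case: p => [[x y]|] //= /eqP <-; rewrite sqrrN. Qed.

Lemma on_curve_add p q : on_curve p -> on_curve q -> on_curve (ec_add_val p q).
Proof.
case: p => [[x1 y1]|] // c1; case: q => [[x2 y2]|] // c2.
case: (ec_addP c1 c2) => // l m x3 _ s _ _.
by rewrite /on_curve sqrrN (secant_on (secantR (secantR s))).
Qed.

Definition ec_zero : ecpoint := @EcPoint None isT.
Definition ec_neg (p : ecpoint) : ecpoint := EcPoint (on_curve_neg (valP p)).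
Definition ec_add (p q : ecpoint) : ecpoint :=
  EcPoint (on_curve_add (valP p) (valP q)).

Lemma ec_add0 : left_id ec_zero ec_add.
Proof. by move=> p; apply: val_inj. Qed.

Lemma ec_addC : commutative ec_add.
Proof.
case=> [[[x1 y1]|] c1] [[[x2 y2]|] c2]; apply: val_inj => //.
change (ec_add_val (Some (x1, y1)) (Some (x2, y2))
  = ec_add_val (Some (x2, y2)) (Some (x1, y1))).
case: (ec_addP c1 c2) => [-> ->|l m x3 h s e1 e2].
  by rewrite ec_add_opp.
rewrite e1 e2 (secant_add (secantC s)) // => -[ex ey]; apply: h; split=> //.
by rewrite e1 e2 ey opprK.
Qed.

Lemma ec_negK : involutive ec_neg.
Proof.
by case=> [[[x y]|] c]; apply: val_inj; rewrite //= opprK.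
Qed.

Lemma ec_addN p : ec_add (ec_neg p) p = ec_zero.
Proof.
rewrite ec_addC; case: p => [[[x y]|] c]; apply: val_inj => //.
exact: ec_add_opp.
Qed.

Lemma ec_addK p q : ec_add (ec_neg p) (ec_add p q) = q.
Proof.
case: q => [[[x2 y2]|] c2]; last first.
  by rewrite (_ : EcPoint c2 = ec_zero) ?[ec_add p _]ec_addC ?ec_add0 ?ec_addN //;
     apply: val_inj.
case: p => [[[x1 y1]|] c1]; last by apply: val_inj.
apply: val_inj.
change (ec_add_val (Some (x1, - y1)) (ec_add_val (Some (x1, y1)) (Some (x2, y2)))
  = Some (x2, y2)).
case: (ec_addP c1 c2) => [-> ->|l m x3 _ s e1 e2] /=; first by rewrite opprK.
have s' := secantN (secantR (secantC s)).
have := secant_add s'; rewrite !mulNr -!opprD !opprK -e1 -e2; apply.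
case=> ex /eqP.
rewrite -ex -e1 eq_sym -addr_eq0 -mulr2n -mulr_natl mulf_eq0.
rewrite (negbTE ec_two_neq0) e1 /=; apply/negP; apply: (@secant_simple l m x1 x2).
by rewrite {2}ex.
Qed.

Lemma ec_negD p q : ec_neg (ec_add p q) = ec_add (ec_neg p) (ec_neg q).
Proof.
case: p => [[[x1 y1]|] c1]; last by apply: val_inj.
case: q => [[[x2 y2]|] c2]; last by apply: val_inj.
apply: val_inj.
change (ec_neg_val (ec_add_val (Some (x1, y1)) (Some (x2, y2)))
  = ec_add_val (Some (x1, - y1)) (Some (x2, - y2))).
case: (ec_addP c1 c2) => [-> ->|l m x3 h s e1 e2] /=.
  by rewrite opprK ec_add_opp.
have := secant_add (secantN s); rewrite !mulNr -!opprD -e1 -e2 => -> //.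
by case=> ex /oppr_inj ey; apply: h; split.
Qed.

(* Associativity for four secant lines in general position.  With
   k := (xA - xC) / (l1 - l2), the lines through (A + B, C) and (A, B + C)
   have slopes k - l1 and k - l2, whether or not they are tangent lines. *)
Lemma ec_addA_secant l1 m1 l2 m2 xA xB xC xS xT :
    l1 != l2 -> l1 * xB + m1 = l2 * xB + m2 ->
    secant l1 m1 xA xB xS -> secant l2 m2 xB xC xT ->
    ~ (xS = xC /\ - (l1 * xS + m1) = - (l2 * xC + m2)) ->
    ~ (xA = xT /\ l1 * xA + m1 = - - (l2 * xT + m2)) ->
  ec_add_val (Some (xA, l1 * xA + m1)) (Some (xT, - (l2 * xT + m2)))
  = ec_add_val (Some (xS, - (l1 * xS + m1))) (Some (xC, l2 * xC + m2)).
Proof.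
rewrite -subr_eq0 => nl eB [s1 s2 s3] [t1 t2 t3] hS hT.
pose k := (xA - xC) / (l1 - l2).
pose yB := l1 * xB + m1.
have n2 := ec_two_neq0.
have eA : xA = xC + k * (l1 - l2) by rewrite /k; field.
have em1 : m1 = yB - l1 * xB by rewrite /yB; ring.
have em2 : m2 = yB - l2 * xB by rewrite /yB eB; ring.
have eS : xS = l1 ^+ 2 - a2 - xA - xB by rewrite -s1; ring.
have eT : xT = l2 ^+ 2 - a2 - xB - xC by rewrite -t1; ring.
have e4 : a4 = xA * xB + xA * xS + xB * xS + 2 * l1 * m1 by rewrite s2; ring.
have e4' : a4 = xB * xC + xB * xT + xC * xT + 2 * l2 * m2 by rewrite t2; ring.
have e6 : a6 = m1 ^+ 2 - xA * xB * xS by rewrite s3; ring.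
have ey : yB = (k * (a2 + xA + xB + xC - l1 ^+ 2) - (xC - xB) * (l1 + l2)) / 2.
  apply: (mulfI (mulf_neq0 n2 nl)).
  have -> : 2 * (l1 - l2) * yB = a4 - a4 + 2 * (l1 - l2) * yB by ring.
  rewrite {1}e4' {1}e4 em1 em2 eT eS eA; field.
  by rewrite n2.
clearbody yB k.
pose xU := (k - l1) ^+ 2 - a2 - xS - xC.
have sU : secant (k - l1) (l2 * xC + m2 - (k - l1) * xC) xS xC xU.
  split; rewrite /xU ?e6 ?e4 ?em1 ?em2 ?eS ?ey ?eA; field; by rewrite ?n2.
have sV : secant (k - l2) (l1 * xA + m1 - (k - l2) * xA) xA xT xU.
  split; rewrite /xU ?e6 ?e4 ?em1 ?em2 ?eS ?eT ?ey ?eA; field; by rewrite ?n2.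
have yS : - (l1 * xS + m1) = (k - l1) * xS + (l2 * xC + m2 - (k - l1) * xC).
  by rewrite em1 em2 eS ey eA; field; rewrite n2.
have yC : l2 * xC + m2 = (k - l1) * xC + (l2 * xC + m2 - (k - l1) * xC) by ring.
have yT : - (l2 * xT + m2) = (k - l2) * xT + (l1 * xA + m1 - (k - l2) * xA).
  by rewrite em1 em2 eT ey eA; field; rewrite n2.
have yA : l1 * xA + m1 = (k - l2) * xA + (l1 * xA + m1 - (k - l2) * xA) by ring.
have := secant_add sV; rewrite -yT -yA => -> //.
have := secant_add sU; rewrite -yS -yC => -> //.
congr (Some (_, - _)).
by rewrite /xU em1 em2 eS ey eA; field; rewrite n2.
Qed.

Lemma ec_addA : associative ec_add.
Proof.
move=> A B C.
have ad0 P : ec_add P ec_zero = P by rewrite ec_addC ec_add0.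
have addK P Q : ec_add P (ec_add (ec_neg P) Q) = Q.
  by rewrite -{1}[P]ec_negK ec_addK.
have [->|nA] := eqVneq A ec_zero; first by rewrite !ec_add0.
have [->|nB] := eqVneq B ec_zero; first by rewrite ad0 ec_add0.
have [->|nC] := eqVneq C ec_zero; first by rewrite !ad0.
have [->|nAC] := eqVneq A C; first by rewrite [RHS]ec_addC [ec_add B C]ec_addC.
have [->|nAB] := eqVneq B (ec_neg A).
  by rewrite addK [ec_add A _]ec_addC ec_addN ec_add0.
have [->|nBC] := eqVneq B (ec_neg C).
  by rewrite ec_addN ad0 [RHS]ec_addC [ec_add A _]ec_addC addK.
have [eS|nS] := eqVneq C (ec_neg (ec_add A B)).
  rewrite [in RHS]eS [RHS]ec_addC ec_addN eS ec_negD.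
  by rewrite [ec_add (ec_neg A) _]ec_addC addK ec_addC ec_addN.
have [eT|nT] := eqVneq A (ec_neg (ec_add B C)).
  rewrite [in LHS]eT ec_addN eT ec_negD.
  rewrite [ec_add (ec_neg B) _]ec_addC [ec_add _ B]ec_addC.
  by rewrite [ec_add (ec_neg C) _]ec_addC addK ec_addN.
case: A nA nAC nAB nS nT => [[[xA yA]|] cA] nA nAC nAB nS nT; last first.
  by case/eqP: nA; apply: val_inj.
case: B nB nAB nBC nS nT => [[[xB yB]|] cB] nB nAB nBC nS nT; last first.
  by case/eqP: nB; apply: val_inj.
case: C nC nAC nBC nS nT => [[[xC yC]|] cC] nC nAC nBC nS nT; last first.
  by case/eqP: nC; apply: val_inj.
have hAC : ~ (xA = xC /\ yA = yC).
  by case=> ex ey; case/eqP: nAC; apply: val_inj; rewrite /= ex ey.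
have hAB : ~ (xA = xB /\ yA = - yB).
  by case=> ex ey; case/eqP: nAB; apply: val_inj; rewrite /= ex ey opprK.
have hBC : ~ (xB = xC /\ yB = - yC).
  by case=> ex ey; case/eqP: nBC; apply: val_inj; rewrite /= ex ey.
have hS :
    Some (xC, yC) <> ec_neg_val (ec_add_val (Some (xA, yA)) (Some (xB, yB))).
  by move=> e; case/eqP: nS; apply: val_inj.
have hT :
    Some (xA, yA) <> ec_neg_val (ec_add_val (Some (xB, yB)) (Some (xC, yC))).
  by move=> e; case/eqP: nT; apply: val_inj.
clear nA nB nC nAC nAB nBC nS nT.
apply: val_inj.
change (ec_add_val (Some (xA, yA)) (ec_add_val (Some (xB, yB)) (Some (xC, yC)))
  = ec_add_val (ec_add_val (Some (xA, yA)) (Some (xB, yB))) (Some (xC, yC))).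
move: hS hT; case: (ec_addP cA cB) => [ex ey|l1 m1 xS _ s eA eB].
  by case: hAB.
case: (ec_addP cB cC) => [ex ey|l2 m2 xT _ t eB' eC]; first by case: hBC.
rewrite /= !opprK => hS hT.
have [el|nl] := eqVneq l1 l2; last first.
  rewrite [in LHS]eA [in RHS]eC; apply: (ec_addA_secant nl _ s t) => //.
  - by rewrite -eB.
  - by case=> ex; rewrite -eC => /(canRL (@opprK _)); rewrite opprK => ey;
       apply: hS; rewrite ex -ey ex.
  - by rewrite -eA opprK => -[ex ey]; apply: hT; rewrite ex ey.
have em : m1 = m2 by apply: (addrI (l1 * xB)); rewrite -eB {1}el.
subst l2 m2; case: s t => s1 s2 s3 [t1 t2 t3].
have : (xC - xA) * (xC - xS) = 0.
  have -> : xS = (l1 ^+ 2 - a2) - xA - xB by rewrite -s1; ring.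
  transitivity (xC * xC + (xB - (l1 ^+ 2 - a2)) * xC +
    xA * (l1 ^+ 2 - a2 - xA - xB)); first by ring.
  have -> : xA * (l1 ^+ 2 - a2 - xA - xB) =
      a4 - 2 * l1 * m1 - xB * (l1 ^+ 2 - a2 - xB).
    by rewrite -s2 -s1; ring.
  by rewrite -t2 -t1; ring.
move/eqP; rewrite mulf_eq0 !subr_eq0 => /orP[] /eqP ex.
  by case: hAC; rewrite eA eC ex.
by case: hS; rewrite eC ex.
Qed.

HB.instance Definition _ :=
  GRing.isZmodule.Build ecpoint ec_addA ec_addC ec_add0 ec_addN.

End Points.

Lemma weierstrass_disc_shift (K : fieldType) (b c d s : K) :
  weierstrass_disc (b + 3 * s) (c + 2 * b * s + 3 * s ^+ 2)
    (d + c * s + b * s ^+ 2 + s ^+ 3) = weierstrass_disc b c d.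
Proof. by rewrite /weierstrass_disc; ring. Qed.

(* The explicit %:R keeps the large numerals folded as Nat.of_num_uint; a bare
   ring_scope numeral would be expanded in unary. *)
Definition e222_a2 (K : fieldType) (t : K) : K := 16 * t + 942 / 13.
Definition e222_a4 (K : fieldType) (t : K) : K :=
  10048%:R / 13 * t + 293084%:R / 169.
Definition e222_a6 (K : fieldType) (t : K) : K :=
  1024 * t ^+ 2 + 1620800%:R / 169 * t + 30250696%:R / 2197.

(* Substituting x = X - 262 / 13 makes the coefficients integral:
   y^2 = X^3 + (16 t + 12) X^2 + (128 t + 32) X + (32 t + 8)^2. *)
Section E222Shift.
Variables (K : fieldType) (t : K).
Hypothesis n13 : (13 : K) != 0.
Let s : K := 262 / 13.

Let n169 : (169 : K) != 0.
Proof. by rewrite (_ : 169 = 13 * 13) ?mulf_neq0 //; ring. Qed.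

Let n2197 : (2197 : K) != 0.
Proof. by rewrite (_ : 2197 = 13 * 169) ?mulf_neq0 //; ring. Qed.

Lemma e222_a2_shift : e222_a2 t = 16 * t + 12 + 3 * s.
Proof. by rewrite /e222_a2 /s; field; rewrite n13. Qed.

Lemma e222_a4_shift :
  e222_a4 t = 128 * t + 32 + 2 * (16 * t + 12) * s + 3 * s ^+ 2.
Proof. by rewrite /e222_a4 /s; field; rewrite n13 n169. Qed.

Lemma e222_a6_shift :
  e222_a6 t = (32 * t + 8) ^+ 2 + (128 * t + 32) * s + (16 * t + 12) * s ^+ 2
              + s ^+ 3.
Proof. by rewrite /e222_a6 /s; field; rewrite n13 n169 n2197. Qed.

Lemma e222_discE :
  weierstrass_disc (e222_a2 t) (e222_a4 t) (e222_a6 t) =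
  - 2 ^+ 16 *
    ((4 * t + 1) ^+ 2 * (256 * t ^+ 3 + 368 * t ^+ 2 + 104 * t + 23)).
Proof.
rewrite e222_a2_shift e222_a4_shift e222_a6_shift weierstrass_disc_shift.
by rewrite /weierstrass_disc; ring.
Qed.

Lemma e222_cubicE x :
  x ^+ 3 + e222_a2 t * x ^+ 2 + e222_a4 t * x + e222_a6 t =
  (x + s) ^+ 3 + (16 * t + 12) * (x + s) ^+ 2 + (128 * t + 32) * (x + s)
  + (32 * t + 8) ^+ 2.
Proof. by rewrite e222_a2_shift e222_a4_shift e222_a6_shift; ring. Qed.

Lemma e222_onP :
  let x := - 262 / 13 in
  (32 * t + 8) ^+ 2 = x ^+ 3 + e222_a2 t * x ^+ 2 + e222_a4 t * x + e222_a6 t.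
Proof. by rewrite /= e222_cubicE /s; field; rewrite n13. Qed.

Lemma e222_onQ :
  let x := - 366 / 13 in
  (32 * t + 8) ^+ 2 = x ^+ 3 + e222_a2 t * x ^+ 2 + e222_a4 t * x + e222_a6 t.
Proof. by rewrite /= e222_cubicE /s; field; rewrite n13. Qed.

End E222Shift.

(* Q(a), with avar the class of the indeterminate. *)
Definition Qa : fieldType := {fraction {poly rat}}.
Definition avar : Qa := tofrac ('X : {poly rat}).

Lemma Qa_natr_neq0 (n : nat) : n != 0%N -> (n%:R : Qa) != 0.
Proof.
move=> n0; rewrite /Qa -(rmorph_nat (@tofrac {poly rat})) tofrac_eq0.
by rewrite -polyC_natr polyC_eq0 Num.Theory.pnatr_eq0.
Qed.

Lemma Qa_13_neq0 : (13 : Qa) != 0.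
Proof. exact: Qa_natr_neq0. Qed.

Lemma Qa_cubic_neq0 (b c d n : nat) : n != 0%N ->
  b%:R * avar ^+ 3 + c%:R * avar ^+ 2 + d%:R * avar + n%:R != 0.
Proof.
move=> n0; pose p : {poly rat} := b%:R * 'X^3 + c%:R * 'X^2 + d%:R * 'X + n%:R.
have -> : b%:R * avar ^+ 3 + c%:R * avar ^+ 2 + d%:R * avar + n%:R = tofrac p.
  by rewrite /p /avar !(rmorphM, rmorphD, rmorphXn, rmorph_nat).
rewrite tofrac_eq0; apply/eqP => /(congr1 (horner^~ 0)) /eqP.
rewrite /p -!polyC_natr !hornerE /=.
rewrite !mulr0 !add0r Num.Theory.pnatr_eq0; exact/negP.
Qed.

Lemma e222_disc_neq0 :
  weierstrass_disc (e222_a2 avar) (e222_a4 avar) (e222_a6 avar) != 0.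
Proof.
rewrite (e222_discE avar Qa_13_neq0).
have n2 : (2 : Qa) != 0 by exact: Qa_natr_neq0.
have n1 : 4 * avar + 1 != 0.
  by have := @Qa_cubic_neq0 0 0 4 1 isT; rewrite !mul0r !add0r.
have n3 : 256 * avar ^+ 3 + 368 * avar ^+ 2 + 104 * avar + 23 != 0.
  exact: (@Qa_cubic_neq0 256 368 104 23 isT).
have n4 : - 2 ^+ 16 != 0 :> Qa by rewrite oppr_eq0; exact: (expf_neq0 16 n2).
exact: (mulf_neq0 n4 (mulf_neq0 (expf_neq0 2 n1) n3)).
Qed.

Definition E222 : ellcurve Qa := EllCurve e222_disc_neq0.

Lemma P222_on_curve : on_curve E222 (Some (- 262 / 13, 32 * avar + 8)).
Proof. by apply/eqP; exact: (e222_onP avar Qa_13_neq0). Qed.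

Lemma Q222_on_curve : on_curve E222 (Some (- 366 / 13, 32 * avar + 8)).
Proof. by apply/eqP; exact: (e222_onQ avar Qa_13_neq0). Qed.

Definition P222 : ecpoint E222 := EcPoint P222_on_curve.
Definition Q222 : ecpoint E222 := EcPoint Q222_on_curve.

(* Main.v *)
Require Import Defs.
From Stdlib Require Import Classical_Prop.
From mathcomp Require Import all_boot all_order all_algebra all_field fraction.
From mathcomp Require Import ring lra zify.

(* In the coordinate w = x + 262/13 and with b = 16 a + 4 the curve is
     Y^2 = w (w + 8) (w + b) + 4 b^2.
   Generation (Nagata's argument).  Putting v = Y - 2 b, the equation reads
   b D = N with D = 4 v - w^2 - 8 w and N = w^2 (w + 8) - v^2, so the surface
   is rational: after inverting D its coordinate ring is Q[w, v, 1/D], a UFD.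
   Hence, for a point S other than +-P, +-Q, +-(2 P + Q), the polynomials in
   (w, v) that vanish at S form a principal ideal (h), and (h) contains the
   ideal of S up to powers of D.  The norm of D over the w-line is
   w^2 (w + 8) (w - 8), so the zeros of h on the curve are S and points of
   abscissa w in {0, -8, 8}, i.e. +-P, +-Q and +-(2 P + Q).  The zeros of a
   function with poles only at infinity add up to zero.
   Independence.  There is no 2-torsion and none of P, Q, P + Q is a double:
   the slope of the tangent at a half would be a root of a monic quartic over
   Q[a], hence a polynomial in a. *)

Set Implicit Arguments.
Unset Strict Implicit.
Unset Printing Implicit Defensive.

Import Order.TTheory GRing.Theory Num.Theory.
Local Open Scope ring_scope.

Local Notation fr := (@tofrac {poly rat}).

(** * Sums of zeros of functions on an elliptic curve *)

Section SumOfZeros.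
Variables (K : fieldType) (E : ellcurve K).
Local Notation a2 := (ec_a2 E).
Local Notation a4 := (ec_a4 E).
Local Notation a6 := (ec_a6 E).

Definition cubicp : {poly K} :=
  'X^3 + a2%:P * 'X^2 + a4%:P * 'X + a6%:P.

Lemma horner_cubicp x : cubicp.[x] = cubic E x.
Proof. by rewrite /cubicp /cubic !hornerE. Qed.

Lemma size_cubicp : size cubicp = 4.
Proof.
rewrite /cubicp -addrA -addrA size_polyDl size_polyXn //.
rewrite ltnS (leq_trans (size_polyD _ _)) // geq_max.
apply/andP; split.
  by rewrite mul_polyC (leq_trans (size_scale_leq _ _)) ?size_polyXn.
rewrite (leq_trans (size_polyD _ _)) // geq_max.
rewrite (leq_trans (size_polyC_leq1 _)) // andbT.
by rewrite mul_polyC (leq_trans (size_scale_leq _ _)) ?size_polyX.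
Qed.

Definition abscissa (p : ecpoint E) : option K := omap fst (ecval p).

Lemma abscissa_eq (p q : ecpoint E) x :
  abscissa p = Some x -> abscissa q = Some x -> p = q \/ p = - q.
Proof.
case: p q => [[[x1 y1]|] c1] [[[x2 y2]|] c2] //= [e1] [e2]; subst x1 x2.
have /eqP : y1 ^+ 2 = y2 ^+ 2 by rewrite (on_curveE c1) (on_curveE c2).
by rewrite eqf_sqr => /orP[] /eqP e; [left|right]; apply: val_inj; rewrite /= e.
Qed.

Lemma abscissaN (p : ecpoint E) : abscissa (- p) = abscissa p.
Proof. by case: p => [[[x y]|] c]. Qed.

Lemma cubicp_secant l m x1 x2 x3 : secant E l m x1 x2 x3 ->
  cubicp - (l *: 'X + m%:P) ^+ 2
    = ('X - x1%:P) * ('X - x2%:P) * ('X - x3%:P).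
Proof.
case=> h1 h2 h3; rewrite /cubicp.
have -> : a2 = l ^+ 2 - (x1 + x2 + x3) by rewrite h1; ring.
have -> : a4 = x1 * x2 + x1 * x3 + x2 * x3 + 2 * l * m by rewrite h2; ring.
have -> : a6 = m ^+ 2 - x1 * x2 * x3 by rewrite h3; ring.
rewrite -mul_polyC; rewrite !(rmorphD, rmorphB, rmorphM, rmorphXn, rmorph_nat).
ring.
Qed.

Hypothesis cubic_neq0 : forall x, cubic E x != 0.

(** The polynomial [al ^+ 2 - be ^+ 2 * cubicp] is the norm of the function [al + be * Y]. Where
    [be] vanishes at a root [r], so does [al]; otherwise the function has a zero over [r], with
    ordinate [- al.[r] / be.[r]]. *)
Lemma norm_root al be r : root (al ^+ 2 - be ^+ 2 * cubicp) r ->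
  ('X - r%:P %| al) && ('X - r%:P %| be) \/
  be.[r] != 0 /\ (- al.[r] / be.[r]) ^+ 2 = cubic E r.
Proof.
rewrite /root; move: (horner_cubicp r); move: cubicp => F eF.
rewrite !hornerE eF => /eqP h; rewrite !dvdp_XsubCl /root.
have [b0|nb] := eqVneq be.[r] 0.
  left; rewrite andbT -sqrf_eq0; apply/eqP.
  by move: h; rewrite b0 expr0n mul0r subr0.
right; split=> //; apply: (mulfI (expf_neq0 2 nb)).
by rewrite -(subr0_eq h); field.
Qed.

(** A function with poles only at infinity never has exactly one zero: the degrees of [al ^+ 2] and
    [be ^+ 2 * cubicp] differ in parity, so leading terms cannot cancel, and the second, if nonzero,
    has degree at least 3. *)
Lemma norm_size al be : size (al ^+ 2 - be ^+ 2 * cubicp) != 2.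
Proof.
have sq (p : {poly K}) : p != 0 -> size (p ^+ 2) = (size p).*2.-1.
  by move=> p0; rewrite expr2 size_mul // addnn.
have [->|b0] := eqVneq be 0.
  rewrite expr0n mul0r subr0; have [->|a0] := eqVneq al 0.
    by rewrite expr0n size_poly0.
  by rewrite sq //; case: (size al) => [|[|n]].
have sb : size (be ^+ 2 * cubicp) = (size be).*2.+2.
  have F0 : cubicp != 0 by rewrite -size_poly_gt0 size_cubicp.
  rewrite size_mul ?expf_neq0 // sq // size_cubicp.
  by rewrite -size_poly_gt0 in b0; case: (size be) b0 => // n _; rewrite !addnS addn0.
have sb0 : (0 < size be)%N by rewrite size_poly_gt0.
have [->|a0] := eqVneq al 0.
  by rewrite expr0n sub0r size_polyN sb; case: (size be) sb0.
have sa := sq _ a0.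
have sa0 : (0 < size al)%N by rewrite size_poly_gt0.
have [lt|gt|eq] := ltngtP (size (al ^+ 2)) (size (be ^+ 2 * cubicp)).
- rewrite [al ^+ 2 + _]addrC size_polyDl ?size_polyN //.
  by rewrite sb; case: (size be) sb0.
- rewrite size_polyDl ?size_polyN // sa.
  by case: (size al) => [|[|n]].
- exfalso; move: eq; rewrite sa sb.
  case: (size al) sa0 => // n _; rewrite doubleS /= => /(congr1 odd).
  by rewrite /= odd_double /= odd_double.
Qed.

(* Removing two zeros on a line and adding the third point of that line
   shortens the list of zeros. *)
Lemma sum_zeros (rs : seq K) (al be : {poly K}) (c : K) :
    c != 0 -> al ^+ 2 - be ^+ 2 * cubicp = c *: \prod_(r <- rs) ('X - r%:P) ->
    (forall r, r \in rs -> exists p, abscissa p = Some r) ->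
  exists2 ps : seq (ecpoint E),
    perm_eq (map abscissa ps) (map Some rs) & \sum_(p <- ps) p = 0.
Proof.
elim: {rs}_.+1 {-2}rs (ltnSn (size rs)) al be c => // n IHn rs.
rewrite ltnS => le_n al be c c0 hN hrs.
(* If ['X - r%:P] divides both, its square divides the norm, so [r] is listed twice; a point over
   [r] and its opposite account for both and add up to zero. *)
have common r : r \in rs -> ('X - r%:P %| al) && ('X - r%:P %| be) ->
  exists2 ps : seq (ecpoint E),
    perm_eq (map abscissa ps) (map Some rs) & \sum_(p <- ps) p = 0.
  move=> rin /andP[/dvdpP[al' ea] /dvdpP[be' eb]].
  have [p hp] := hrs _ rin.
  have prs := perm_to_rem rin.
  have nr : 'X - r%:P != 0 by rewrite polyXsubC_eq0.
  have h1 : ('X - r%:P) * (al' ^+ 2 - be' ^+ 2 * cubicp) =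
      c *: \prod_(r <- rem r rs) ('X - r%:P).
    apply: (mulfI nr); rewrite -scalerAr.
    have <- := @big_rem _ _ _ _ rs r predT (fun x => 'X - x%:P) rin.
    by rewrite -hN ea eb; ring.
  have rin' : r \in rem r rs.
    have : root (c *: \prod_(r <- rem r rs) ('X - r%:P)) r.
      by rewrite -h1 rootM root_XsubC eqxx.
    by rewrite rootZ // root_prod_XsubC.
  have prs' := perm_to_rem rin'.
  have [] := IHn (rem r (rem r rs)) _ al' be' c c0 _.
  - move: le_n; rewrite (perm_size prs) /= (perm_size prs') /=; exact: ltn_trans.
  - apply: (mulfI nr); rewrite h1 -scalerAr; congr (_ *: _).
    exact: @big_rem _ _ _ _ (rem r rs) r predT (fun x => 'X - x%:P) rin'.
  - by move=> x /mem_rem/mem_rem; apply: hrs.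
  move=> ps hps sps; exists (p :: - p :: ps); last first.
    by rewrite !big_cons sps addr0 subrr.
  rewrite /= abscissaN hp perm_sym.
  rewrite (perm_trans (perm_map _ prs)) //= perm_cons.
  by rewrite (perm_trans (perm_map _ prs')) //= perm_cons perm_sym.
case: rs hN hrs le_n common => [|r1 [|r2 rs]] hN hrs le_n common.
- by exists [::]; rewrite ?big_nil.
- have := norm_size al be; rewrite hN size_scale // big_seq1 size_XsubC.
  by rewrite eqxx.
have rt r : r \in [:: r1, r2 & rs] -> root (al ^+ 2 - be ^+ 2 * cubicp) r.
  by move=> hr; rewrite hN rootZ // root_prod_XsubC.
have in1 : r1 \in [:: r1, r2 & rs] by rewrite inE eqxx.
have in2 : r2 \in [:: r1, r2 & rs] by rewrite !inE eqxx orbT.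
have [/(common _ in1) //|[nb1 e1]] := norm_root (rt _ in1).
have [/(common _ in2) //|[nb2 e2]] := norm_root (rt _ in2).
set y1 := (X in X ^+ 2) in e1; set y2 := (X in X ^+ 2) in e2.
have c1 : on_curve E (Some (r1, y1)) by apply/eqP.
have c2 : on_curve E (Some (r2, y2)) by apply/eqP.
have y10 : y1 != 0 by rewrite -sqrf_eq0 e1.
have n2 := ec_two_neq0 E.
pose S1 := EcPoint c1; pose S2 := EcPoint c2.
have eS : ecval (S1 + S2) = ec_add_val E (Some (r1, y1)) (Some (r2, y2)) by [].
case: (ec_addP c1 c2) eS => [ex ey|l m r3 _ hs ey1 ey2] eS.
  (* [y1] and [y2] are the same expression at [r1] and [r2], so opposite points over one abscissa
     would force [y1 = 0]. *)
  exfalso; move: ey; rewrite /y2 -ex -/y1 => /eqP.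
  by rewrite -addr_eq0 -mulr2n -mulr_natl mulf_eq0 (negbTE n2) (negbTE y10).
have eL := cubicp_secant hs.
have hL1 : (l *: 'X + m%:P).[r1] = y1 by rewrite !hornerE.
have hL2 : (l *: 'X + m%:P).[r2] = y2 by rewrite !hornerE.
move: (l *: 'X + m%:P) => L in eL hL1 hL2.
pose M := ('X - r1%:P) * ('X - r2%:P).
have nM : M != 0 by rewrite mulf_neq0 ?polyXsubC_eq0.
have eq1 : (al + be * L).[r1] = 0.
  by rewrite !hornerE hL1 /y1; field.
have eq2 : (al + be * L).[r2] = 0.
  by rewrite !hornerE hL2 /y2; field.
clearbody y1 y2.
(* The restriction of [al + be * Y] to the line vanishes at [r1] and [r2]. When these coincide, the
   double root is read off the product with [al - be * L], which does not vanish at [r1]. *)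
have dv : M %| al + be * L.
  have [e12|n12] := eqVneq r1 r2; last first.
    rewrite Gauss_dvdp ?coprimep_XsubC2 ?subr_eq0 1?eq_sym //.
    by rewrite !dvdp_XsubCl /root eq1 eq2 eqxx.
  have : M %| (al + be * L) * (al - be * L).
    rewrite (_ : _ * _ = al ^+ 2 - be ^+ 2 * cubicp
      + be ^+ 2 * (cubicp - L ^+ 2)); last by ring.
    rewrite hN eL dvdp_add //.
      by rewrite dvdpZr // !big_cons mulrA dvdp_mulIl.
    by rewrite -/M mulrCA dvdp_mulIl.
  rewrite Gauss_dvdpl // /M -e12 coprimepMl andbb coprimep_sym coprimep_XsubC.
  apply/negP => /rootP; rewrite !hornerE hL1 => h.
  have /eqP : 2 * be.[r1] * y1 = 0.
    move: eq1; rewrite !hornerE hL1 => h1.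
    transitivity ((al.[r1] + be.[r1] * y1) - (al.[r1] - be.[r1] * y1)).
      by ring.
    by rewrite h1 h subrr.
  by rewrite !mulf_eq0 (negbTE n2) (negbTE nb1) (negbTE y10).
have [be' eb'] := dvdpP _ _ dv.
(* [al' + be' * Y] is [(al + be * Y) * (L + Y) / M]. The factor [L + Y] vanishes at [- S1], [- S2]
   and [S1 + S2], and [M] at [S1], [S2] and their opposites; this trades the zeros [S1], [S2] for
   [S1 + S2]. *)
pose al' := be * ('X - r3%:P) + be' * L.
have ea' : be * cubicp + al * L = al' * M.
  rewrite (_ : cubicp = L ^+ 2 + (cubicp - L ^+ 2)); last by ring.
  rewrite eL /al' (_ : al = (al + be * L) - be * L); last by ring.
  rewrite eb' /M; ring.
have hN' : al' ^+ 2 - be' ^+ 2 * cubicp =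
    (- c) *: \prod_(r <- r3 :: rs) ('X - r%:P).
  apply: (mulfI (mulf_neq0 nM nM)).
  transitivity ((al' * M) ^+ 2 - (be' * M) ^+ 2 * cubicp); first by ring.
  rewrite -ea' -eb'.
  transitivity (- ((al ^+ 2 - be ^+ 2 * cubicp) * (cubicp - L ^+ 2))); first by ring.
  rewrite hN eL /M !big_cons -!mul_polyC polyCN; ring.
have ab3 : abscissa (S1 + S2) = Some r3 by rewrite /abscissa eS.
have [] := IHn (r3 :: rs) _ al' be' (- c) _ hN'.
- by move: le_n.
- by rewrite oppr_eq0.
- move=> r; rewrite inE => /predU1P[->|hr]; first by exists (S1 + S2).
  by apply: hrs; rewrite !inE hr !orbT.
move=> ps hps sps.
have /mapP[p3 p3in /esym ap3] : Some r3 \in map abscissa ps.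
  by rewrite (perm_mem hps) inE eqxx.
have pps := perm_to_rem p3in.
have hps' : perm_eq (map abscissa (rem p3 ps)) (map Some rs).
  have := perm_map abscissa pps; rewrite perm_sym => /perm_trans/(_ hps).
  by rewrite /= ap3 perm_cons.
(* Induction provides only some point over [r3], that is [S1 + S2] up to sign; the sign is passed on
   to [S1] and [S2]. *)
have : exists q1 q2 : ecpoint E,
    [/\ abscissa q1 = Some r1, abscissa q2 = Some r2 & q1 + q2 = p3].
  have [->|->] := abscissa_eq ap3 ab3; first by exists S1, S2.
  by exists (- S1), (- S2); rewrite !abscissaN opprD.
move=> [q1 [q2 [h1 h2 h3]]].
exists [:: q1, q2 & rem p3 ps]; first by rewrite /= h1 h2 !perm_cons.
rewrite !big_cons addrA h3 -[RHS]sps; apply: esym.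
exact: (@big_rem _ _ _ _ ps p3 predT id p3in).
Qed.

End SumOfZeros.

(** * Kernels of evaluations of Q[x][z] *)

Lemma ex_min_measure (T : Type) (P : T -> Prop) (m : T -> nat) :
  (exists x, P x) -> exists2 x, P x & forall y, P y -> (m x <= m y)%N.
Proof.
case=> x0; elim: {x0}_.+1 {-2}x0 (ltnSn (m x0)) => // n IHn x le_n Px.
have [[y [Py lt_yx]]|no] := classic (exists y, P y /\ (m y < m x)%N).
  exact: (IHn y (leq_trans lt_yx le_n)).
exists x => // y Py; rewrite leqNgt; apply/negP => lt_yx; apply: no.
by exists y.
Qed.

Definition primitive (h : {poly {poly rat}}) : Prop :=
  forall p h', h = p%:P * h' -> (size p <= 1)%N.

(** Gauss's lemma, by induction on the degree of [c]: a prime factor [p] of [c] divides all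
    coefficients of [q * h], hence those of [q], as [h] is primitive. Taking [p] as the minimal
    polynomial of an algebraic number [z] turns reduction modulo [p] into evaluation at [z], with
    values in a field. *)
Lemma Gauss_divisor (c : {poly rat}) (g q h : {poly {poly rat}}) :
  c != 0 -> primitive h -> c%:P * g = q * h -> exists q', g = q' * h.
Proof.
move=> c0 prim_h.
elim: {c}_.+1 {-2}c (ltnSn (size c)) c0 q => // n IHn c le_n c0 q e.
have [c1|nc1] := eqVneq (size c) 1.
  have /size_poly1P[d d0 ec] : size c == 1 by rewrite c1.
  exists (d^-1%:P%:P * q); rewrite -mulrA -e ec mulrA -!polyCM mulVf // mul1r //.
have [z rz] : exists z : algC, root (map_poly ratr c) z.
  by apply/closed_rootP; rewrite size_map_poly.
have [p [_ /monic_neq0 p0] dvp] := minCpolyP z.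
have pz : root (map_poly ratr p) z by rewrite dvp.
have size_p : (1 < size p)%N.
  by have := root_size_gt1 _ pz; rewrite size_map_poly map_poly_eq0; apply.
have [c' ec] : exists c', c = c' * p by apply/dvdpP; rewrite -dvp.
pose chi : {rmorphism {poly rat} -> algC} := horner_eval z \o map_poly ratr.
have chi0 (f : {poly {poly rat}}) : map_poly chi f = 0 -> exists f', f = p%:P * f'.
  move=> hf; exists (map_poly (fun a => a %/ p) f); apply/polyP => i.
  rewrite coefCM coef_map_id0 ?div0p // mulrC divpK // -dvp.
  by have /polyP/(_ i) := hf; rewrite coef0 coef_map /= => /eqP.
have /eqP : map_poly chi (q * h) = 0.
  have chip : chi p = 0 by apply/rootP.
  have chic : chi c = 0 by rewrite ec (rmorphM chi) chip mulr0.
  have chiC : map_poly chi c%:P = 0.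
    by apply: etrans (map_polyC _ _) _; rewrite -[RHS]polyC0; congr (_%:P).
  rewrite -e rmorphM; apply/eqP; rewrite mulf_eq0; apply/orP; left; exact/eqP.
rewrite rmorphM mulf_eq0 => /orP[] /eqP /chi0 [f' ef]; last first.
  by have := prim_h _ _ ef; rewrite leqNgt size_p.
have c'0 : c' != 0 by apply: contra_neq c0 => c'0; rewrite ec c'0 mul0r.
apply: (IHn c' _ c'0 f').
  move: le_n; rewrite ltnS; apply: leq_trans.
  rewrite ec size_mul //; case: (size p) size_p => [|[|k]] // _.
  by rewrite !addnS /= ltnS leq_addr.
apply: (@mulfI _ p%:P); first by rewrite polyC_eq0.
by rewrite !mulrA -polyCM mulrC -ef -e mulrC ec; congr (_ * _); rewrite mulrC.
Qed.

(** Take [h] in the kernel of least outer degree and, among those, with leading coefficient of least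
    degree. Removing an inner factor stays in the kernel by injectivity and would lower the latter,
    so [h] is primitive. Pseudo-division by [h] leaves no remainder, and Gauss's lemma cancels the
    power of the leading coefficient. *)
Lemma kernel_principal (K : idomainType) (ev : {rmorphism {poly {poly rat}} -> K}) :
    (forall p : {poly rat}, ev p%:P = 0 -> p = 0) ->
    (exists2 g, g != 0 & ev g = 0) ->
  exists h, ev h = 0 /\ forall g, ev g = 0 -> exists q, g = q * h.
Proof.
move=> ev_inj [g0 g00 evg0].
have [|h1 [h10 evh1] min1] := @ex_min_measure _ (fun h => h != 0 /\ ev h = 0)
  (fun h => size (h : {poly _})); first by exists g0.
have [|h [h0 evh sh] min2] := @ex_min_measure _
  (fun h => [/\ h != 0, ev h = 0 & size h = size h1])
  (fun h => size (lead_coef h)); first by exists h1.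
have prim_h : primitive h.
  move=> p h' eh; rewrite leqNgt; apply/negP => sp.
  have p0 : p != 0 by rewrite -size_poly_gt0 ltnW.
  have h'0 : h' != 0 by apply: contra_neq h0 => h'0; rewrite eh h'0 mulr0.
  have evh' : ev h' = 0.
    have /eqP := evh; rewrite eh rmorphM mulf_eq0 => /orP[] /eqP // /ev_inj e.
    by rewrite e eqxx in p0.
  have eS : size h = size h' by rewrite eh mul_polyC size_scale.
  have := min2 h'; rewrite -eS => /(_ (And3 h'0 evh' sh)).
  rewrite eh mul_polyC lead_coefZ size_mul ?lead_coef_eq0 //.
  case: (size p) sp => [|[|k]] // _.
  by rewrite !addSn /= ltnNge leq_addl.
exists h; split=> // g evg.
pose c := lead_coef h ^+ Pdiv.Idomain.scalp g h.
have eg := Pdiv.Idomain.divp_eq g h.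
have c0 : c != 0 by rewrite expf_neq0 // lead_coef_eq0.
have r0 : g %% h = 0.
  apply/eqP; apply/negPn/negP => r0.
  have evr : ev (g %% h) = 0.
    have := congr1 ev eg; rewrite -mul_polyC rmorphD !rmorphM evg evh !mulr0 add0r.
    by move=> <-.
  have := min1 _ (conj r0 evr); rewrite -sh leqNgt ltn_modp h0 //.
apply: (@Gauss_divisor c g (g %/ h) h) => //.
by rewrite mul_polyC eg r0 addr0.
Qed.

(** * The field Q(a) *)

Lemma Qa_fracP (x : Qa) : exists A B : {poly rat},
  [/\ B != 0, coprimep A B & x = fr A / fr B].
Proof.
have [A [B [B0 e]]] : exists A B : {poly rat}, B != 0 /\ x = fr A / fr B.
  elim/quotW: x => r; exists (\n_r), (\d_r); split; first exact: denom_ratioP.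
  have d0 : fr \d_r != 0 by rewrite tofrac_eq0 denom_ratioP.
  apply: (mulIf d0); rewrite mulfVK //.
  unlock tofrac; rewrite -[LHS]FracField.pi_mul /FracField.mulf.
  apply/eqmodP; rewrite /= FracField.equivfE /=.
  rewrite !numden_Ratio ?oner_neq0 ?mulf_neq0 ?denom_ratioP //.
  - by apply/eqP; ring.
  - exact: oner_neq0.
  - exact: oner_neq0.
have g0 : gcdp A B != 0 by rewrite gcdp_eq0 negb_and B0 orbT.
exists (A %/ gcdp A B), (B %/ gcdp A B); split.
- by rewrite dvdp_div_eq0 ?dvdp_gcdr.
- by rewrite coprimep_div_gcd // B0 orbT.
have n0 : fr (B %/ gcdp A B) != 0 by rewrite tofrac_eq0 dvdp_div_eq0 ?dvdp_gcdr.
have n1 : fr B != 0 by rewrite tofrac_eq0.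
suff h : A * (B %/ gcdp A B) = A %/ gcdp A B * B.
  by apply/eqP; rewrite e (eqr_div _ _ n1 n0) -!(rmorphM fr) h eqxx.
have dA := dvdp_gcdl A B; have dB := dvdp_gcdr A B.
by rewrite -{1}(divpK dA) -mulrA; congr (_ * _); rewrite mulrC divpK.
Qed.

(** Q[a] is integrally closed: after clearing denominators [B] divides [A ^+ n], and being coprime
    to [A] it is constant. The list [c] holds the lower coefficients of a monic equation, moved to
    the right-hand side. *)
Lemma Qa_integral (c : seq {poly rat}) (l : Qa) :
    l ^+ size c = \sum_(i < size c) fr c`_i * l ^+ i ->
  exists L, l = fr L.
Proof.
have [A [B [B0 co ->]]] := Qa_fracP l; set n := size c => e.
have n1 : fr B != 0 by rewrite tofrac_eq0.
have dvBA : B %| A ^+ n.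
  have eA : A ^+ n = \sum_(i < n) c`_i * A ^+ i * B ^+ (n - i).
    apply/eqP; rewrite -tofrac_eq; apply/eqP.
    rewrite rmorph_sum rmorphXn -[LHS](mulfVK (expf_neq0 n n1)) -expr_div_n e.
    rewrite mulr_suml; apply: eq_bigr => i _.
    rewrite !rmorphM !rmorphXn -!mulrA; congr (_ * _).
    have -> : fr B ^+ n = fr B ^+ i * fr B ^+ (n - i).
      by rewrite -exprD subnKC // ltnW.
    by rewrite mulrA -exprMn mulfVK.
  rewrite eA; elim/big_rec: _ => [|i x _ IH]; first exact: dvdp0.
  by rewrite dvdp_add // dvdp_mull // dvdp_exp ?subn_gt0 // ltn_ord.
have : size B == 1.
  have coBA : coprimep B (A ^+ n) by rewrite coprimep_sym coprimep_expl.
  by rewrite -coprimepp (coprimep_dvdl dvBA).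
case/size_poly1P => k k0 eB.
exists (k^-1 *: A); rewrite -mul_polyC rmorphM mulrC; congr (_ * _).
apply: (mulIf n1); rewrite mulVf // eB -rmorphM -polyCM mulVf //.
Qed.

(** Such an [x] is integral, hence a polynomial [L], and a nonzero polynomial composed with a
    nonconstant [L] stays nonzero. *)
Lemma Qa_transcendental (p : {poly rat}) (x : Qa) : p != 0 ->
  (map_poly (fr \o polyC) p).[x] = 0 -> exists c : rat, x = fr c%:P.
Proof.
move=> p0; pose q : {poly rat} := (lead_coef p)^-1 *: p.
have l0 : lead_coef p != 0 by rewrite lead_coef_eq0.
have mq : lead_coef q = 1 by rewrite lead_coefZ mulVf.
have sq : size q = (size p).-1.+1.
  by rewrite size_scale ?invr_eq0 // prednK // size_poly_gt0.
move=> px; have qx : (map_poly (fr \o polyC) q).[x] = 0.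
  rewrite /q -mul_polyC rmorphM /= map_polyC hornerM px mulr0 //.
have [L eL] : exists L, x = fr L.
  apply: (@Qa_integral (mkseq (fun i => - (q`_i)%:P) (size p).-1) x).
  rewrite size_mkseq; move: qx; rewrite horner_coef size_map_poly sq.
  rewrite big_ord_recr /= !coef_map /= -[(size p).-1]/((size p).-1.+1.-1) -sq.
  rewrite -lead_coefE mq !rmorph1 mul1r => /eqP.
  rewrite addrC addr_eq0 sq => /eqP ->; rewrite -sumrN; apply: eq_bigr => i _.
  by rewrite coef_map nth_mkseq // rmorphN mulNr.
move: qx; rewrite eL.
have -> : (map_poly (fr \o polyC) q).[fr L] = fr (q \Po L).
  rewrite /comp_poly -horner_map -map_poly_comp //.
move/eqP; rewrite tofrac_eq0 => h.
have [/comp_poly_eq0 e|] := ltnP 1 (size L).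
  by move: h; rewrite e -lead_coef_eq0 mq oner_eq0.
by move=> /size1_polyC eLc; exists L`_0; rewrite -eLc.
Qed.

(** * Doubles on E222 *)

Definition shift : Qa := 262 / 13.
Definition bpoly : {poly rat} := 16 * 'X + 4.
Definition bvar : Qa := tofrac bpoly.

Lemma bvarE : bvar = 16 * avar + 4.
Proof. by rewrite /bvar /bpoly rmorphD rmorphM !rmorph_nat. Qed.

Lemma E222_a2E : ec_a2 E222 = bvar + 8 + 3 * shift.
Proof.
by rewrite /= (e222_a2_shift _ Qa_13_neq0) bvarE /shift; congr (_ + _); ring.
Qed.

Lemma E222_a4E :
  ec_a4 E222 = 8 * bvar + 2 * (bvar + 8) * shift + 3 * shift ^+ 2.
Proof.
rewrite /= (e222_a4_shift _ Qa_13_neq0) bvarE -/shift.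
by move: shift avar => s t; ring.
Qed.

Lemma E222_a6E : ec_a6 E222 =
  4 * bvar ^+ 2 + 8 * bvar * shift + (bvar + 8) * shift ^+ 2 + shift ^+ 3.
Proof.
rewrite /= (e222_a6_shift _ Qa_13_neq0) bvarE -/shift.
by move: shift avar => s t; ring.
Qed.

Lemma E222_cubicE x : cubic E222 x =
  (x + shift) ^+ 3 + (bvar + 8) * (x + shift) ^+ 2 + 8 * bvar * (x + shift)
  + 4 * bvar ^+ 2.
Proof.
by rewrite /cubic E222_a2E E222_a4E E222_a6E; move: shift bvar => s t; ring.
Qed.

Lemma size_add_le (p q : {poly rat}) n :
  (size p <= n)%N -> (size q <= n)%N -> (size (p + q)%R <= n)%N.
Proof. by move=> hp hq; rewrite (leq_trans (size_polyD _ _)) // geq_max hp. Qed.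

Lemma size_mul_le (p q : {poly rat}) m k n :
  (size p <= m.+1)%N -> (size q <= k.+1)%N -> (m + k < n)%N ->
  (size (p * q)%R <= n)%N.
Proof.
move=> hp hq; apply: leq_trans; rewrite (leq_trans (size_polyMleq _ _)) //.
by rewrite -subn1 leq_subLR add1n -addnS -addSn leq_add.
Qed.

Lemma size_exp_le (p : {poly rat}) m k n :
  (size p <= m.+1)%N -> (m * k < n)%N -> (size (p ^+ k)%R <= n)%N.
Proof.
move=> hp; apply: leq_trans; rewrite (leq_trans (size_poly_exp_leq _ _)) //.
by rewrite ltnS leq_mul // -ltnS; case: (size p) hp.
Qed.

Lemma size_num_leq n : (size (n%:R : {poly rat}) <= 1)%N.
Proof. by rewrite -polyC_natr size_polyC_leq1. Qed.

Lemma size_bpoly : (size bpoly <= 2)%N.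
Proof.
apply: size_add_le; last exact: leq_trans (size_num_leq _) _.
by apply: (@size_mul_le _ _ 0 1); rewrite ?size_polyX ?size_num_leq.
Qed.

Lemma size_expE (p : {poly rat}) n : p != 0 -> size (p ^+ n) = ((size p).-1 * n).+1%N.
Proof. by move=> p0; rewrite -size_exp prednK // size_poly_gt0 expf_neq0. Qed.

Lemma horner_bpoly x : bpoly.[x] = 16 * x + 4.
Proof. by rewrite /bpoly -!polyC_natr !hornerE. Qed.

Lemma size2_polyE (p : {poly rat}) : (size p <= 2)%N -> p = (p`_1)%:P * 'X + (p`_0)%:P.
Proof.
move=> hp; apply/polyP => -[|[|i]]; rewrite coefD coefMX !coefC //= ?add0r ?addr0 //.
by rewrite nth_default // (leq_trans hp).
Qed.

(** There is no 2-torsion: a root would be a polynomial [L] in a. In degree 2 or more [L ^+ 3]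
    dominates the other terms; in degree at most 1 the coefficients in b are incompatible. *)
Lemma E222_cubic_neq0 x : cubic E222 x != 0.
Proof.
apply/eqP; rewrite E222_cubicE; move: (x + shift) => {x} w e.
have [L eL] : exists L, w = fr L.
  apply: (@Qa_integral [:: - (4 * bpoly ^+ 2); - (8 * bpoly); - (bpoly + 8)]).
  rewrite /= !big_ord_recl big_ord0 /= /bump /=.
  transitivity (w ^+ 3 - (w ^+ 3 + (bvar + 8) * w ^+ 2 + 8 * bvar * w
    + 4 * bvar ^+ 2)); first by rewrite e subr0.
  by rewrite /bvar; ring.
have {e} : fr (L ^+ 3 + ((bpoly + 8) * L ^+ 2 + 8 * bpoly * L
    + 4 * bpoly ^+ 2)) = 0.
  by rewrite -e eL /bvar; ring.
move/eqP; rewrite tofrac_eq0 addr_eq0 => /eqP e.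
have [/size2_polyE eL2|sL] := leqP (size L) 2.
  have [c [e0 ev]] : exists c e0 : rat, forall t : rat, (c * t + e0) ^+ 3
     + (t + 8) * (c * t + e0) ^+ 2 + 8 * t * (c * t + e0) + 4 * t ^+ 2 = 0.
    (* At a = (t - 4) / 16 the value of b is [t], so this rewrites [L] as a polynomial in b. *)
    exists (L`_1 / 16), (L`_0 - L`_1 / 4) => t.
    pose ev : {rmorphism {poly rat} -> rat} := horner_eval ((t - 4) / 16).
    have evL : ev L = L`_1 / 16 * t + (L`_0 - L`_1 / 4).
      by rewrite /ev /= /horner_eval {1}eL2 hornerD hornerM !hornerC hornerX; field.
    have evb : ev bpoly = t by rewrite /ev /= /horner_eval horner_bpoly; field.
    have e' : ev (L ^+ 3 + ((bpoly + 8) * L ^+ 2 + 8 * bpoly * L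
       + 4 * bpoly ^+ 2)) = 0 by rewrite e addrC subrr rmorph0.
    by rewrite -[RHS]e' -evL -[t in LHS]evb; ring.
  have ev0 := ev 0; have ev1 := ev 1; have evm := ev (-1); have ev2 := ev 2.
  have c3 : c ^+ 2 * (c + 1) = 0 by lra.
  have c2 : 3 * c ^+ 2 * e0 + 8 * c ^+ 2 + 2 * c * e0 + 8 * c + 4 = 0 by lra.
  have c0 : e0 ^+ 3 + 8 * e0 ^+ 2 = 0 by lra.
  move/eqP: c3; rewrite mulf_eq0 expf_eq0 /= addr_eq0 => /orP[] /eqP ec.
    by move: c2; rewrite ec; lra.
  have ee : e0 = -4 by move: c2; rewrite ec; lra.
  by move: c0; rewrite ee; lra.
have L0 : L != 0 by rewrite -size_poly_gt0 (leq_trans _ sL).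
have := size_expE 3 L0; rewrite e size_polyN.
set n := (size L).-1 => eS.
have sL' : (size L <= n.+1)%N by rewrite prednK // size_poly_gt0.
have n2 : (2 <= n)%N by rewrite /n; lia.
suff : (size ((bpoly + 8) * L ^+ 2 + 8 * bpoly * L + 4 * bpoly ^+ 2)%R
         <= (n * 2).+2)%N.
  by rewrite eS; lia.
have sb := size_bpoly; have s8 := size_num_leq 8; have s4 := size_num_leq 4.
have s2 : (size (L ^+ 2)%R <= (n * 2).+1)%N by apply: size_exp_le sL' _.
apply: size_add_le; first apply: size_add_le.
- apply: (@size_mul_le _ _ 1 (n * 2)); [|exact: s2|lia].
  by apply: size_add_le => //; apply: leq_trans s8 _.
- apply: (@size_mul_le _ _ 1 n); [|exact: sL'|lia].
  exact: (@size_mul_le _ _ 0 1).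
- apply: (@size_mul_le _ _ 0 2); [exact: s4| |lia].
  exact: (@size_exp_le _ 1).
Qed.

(* l is the slope of the tangent at S and w the shifted abscissa of S. *)
Lemma E222_double (S : ecpoint E222) x y : ecval (S + S) = Some (x, y) ->
  exists l w, 2 * w + (x + shift) = l ^+ 2 - (bvar + 8) /\
    w ^+ 2 + 2 * w * (x + shift) = 8 * bvar + 2 * l * (y + l * (x + shift)).
Proof.
case: S => [[[x1 y1]|] c1] //.
have -> : ecval (EcPoint c1 + EcPoint c1)
  = ec_add_val E222 (Some (x1, y1)) (Some (x1, y1)) by [].
have c1' := c1; case: (ec_addP c1 c1') => // l m x3 _ [h1 h2 _] _ _ [<- <-].
exists l, (x1 + shift); rewrite E222_a2E in h1; rewrite E222_a4E in h2.
move: shift bvar h1 h2 => s b h1 h2; split.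
  have -> : l ^+ 2 = x1 + x1 + x3 + (b + 8 + 3 * s) by rewrite h1; ring.
  by ring.
have e : l ^+ 2 = x1 + x1 + x3 + (b + 8 + 3 * s) by rewrite h1; ring.
have -> : 2 * l * (- (l * x3 + m) + l * (x3 + s))
    = - 2 * l * m + 2 * s * l ^+ 2 by ring.
have -> : - 2 * l * m
  = x1 * x1 + x1 * x3 + x1 * x3 - (8 * b + 2 * (b + 8) * s + 3 * s ^+ 2).
  by rewrite h2; ring.
by rewrite e; ring.
Qed.

Lemma shift_eqs : - 262 / 13 + shift = 0 /\ - 366 / 13 + shift = - 8.
Proof. by have h := Qa_13_neq0; split; rewrite /shift; field. Qed.

Lemma P222_not_double (S : ecpoint E222) : S + S <> P222.
Proof.
move=> /(congr1 (@ecval _ E222))/E222_double[l [w]].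
have -> : 32 * avar + 8 = 2 * bvar by rewrite bvarE; ring.
rewrite (proj1 shift_eqs) addr0 mulr0 !addr0 => -[h1 h2].
(* Squaring [2 * w] and inserting the second relation eliminates [w]. *)
have {h1 h2} e : (l ^+ 2 - (bvar + 8)) ^+ 2 - 16 * bvar * (l + 2) = 0.
  rewrite -h1 exprMn h2; ring.
have [L eL] : exists L, l = fr L.
  apply: (@Qa_integral
    [:: 32 * bpoly - (bpoly + 8) ^+ 2; 16 * bpoly; 2 * (bpoly + 8); 0]).
  rewrite /= !big_ord_recl big_ord0 /= /bump /=.
  transitivity (l ^+ 4 - ((l ^+ 2 - (bvar + 8)) ^+ 2 - 16 * bvar * (l + 2))).
    by rewrite e subr0.
  by rewrite /bvar; ring.
have {e} : fr ((L ^+ 2 - (bpoly + 8)) ^+ 2 - 16 * bpoly * (L + 2)) = 0.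
  by rewrite -e eL /bvar; ring.
move/eqP; rewrite tofrac_eq0 => /eqP e.
(* At b = -100 the points P and Q lie on the bounded real component, so the
   quartic has no real root. *)
pose ev : {rmorphism {poly rat} -> rat} := horner_eval (- 104 / 16).
have evb : ev bpoly = - 100 by rewrite /ev /= /horner_eval horner_bpoly; field.
have : (ev L ^+ 2 - (ev bpoly + 8)) ^+ 2 - 16 * ev bpoly * (ev L + 2) = 0.
  by rewrite -[RHS](rmorph0 ev) -e; ring.
rewrite evb; nra.
Qed.

Lemma Q222_not_double (S : ecpoint E222) : S + S <> Q222.
Proof.
move=> /(congr1 (@ecval _ E222))/E222_double[l [w]].
have -> : 32 * avar + 8 = 2 * bvar by rewrite bvarE; ring.
rewrite (proj2 shift_eqs) => -[h1 h2].
have {h1 h2} e : (bvar - l ^+ 2) ^+ 2 - 16 * bvar * l + 32 * l ^+ 2 = 0.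
  have h3 : l ^+ 2 = 2 * w + bvar by rewrite -[LHS](subrK (bvar + 8)) -h1; ring.
  have h4 : w ^+ 2 = 8 * bvar + 2 * l * (2 * bvar + l * -8) - 2 * w * -8.
    by rewrite -h2; ring.
  transitivity (4 * w ^+ 2 - 16 * bvar * l + 32 * l ^+ 2).
    by rewrite h3; ring.
  rewrite h4 (_ : 2 * l * (2 * bvar + l * -8) = 4 * bvar * l - 16 * l ^+ 2).
    by rewrite h3; ring.
  by ring.
have [L eL] : exists L, l = fr L.
  apply: (@Qa_integral [:: - bpoly ^+ 2; 16 * bpoly; 2 * bpoly - 32; 0]).
  rewrite /= !big_ord_recl big_ord0 /= /bump /=.
  transitivity (l ^+ 4 - ((bvar - l ^+ 2) ^+ 2 - 16 * bvar * l + 32 * l ^+ 2)).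
    by rewrite e subr0.
  by rewrite /bvar; ring.
have {e} : fr ((bpoly - L ^+ 2) ^+ 2 - 16 * bpoly * L + 32 * L ^+ 2) = 0.
  by rewrite -e eL /bvar; ring.
move/eqP; rewrite tofrac_eq0 => /eqP e.
pose ev : {rmorphism {poly rat} -> rat} := horner_eval (- 104 / 16).
have evb : ev bpoly = - 100 by rewrite /ev /= /horner_eval horner_bpoly; field.
have : (ev bpoly - ev L ^+ 2) ^+ 2 - 16 * ev bpoly * ev L + 32 * ev L ^+ 2 = 0.
  by rewrite -[RHS](rmorph0 ev) -e; ring.
(* At b = -100 the left side is [(l ^+ 2 + 100) ^+ 2 + 32 * l ^+ 2 + 1600 * l] with [l = ev L],
   which is positive. *)
rewrite evb; nra.
Qed.

(** P and Q have the same ordinate 2 b, so their secant is horizontal and meets the curve again at w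
    = - b. *)
Lemma E222_addPQ : exists2 x, x + shift = - bvar &
  ecval (P222 + Q222) = Some (x, - (2 * bvar)).
Proof.
have [eP eQ] := shift_eqs.
have -> : ecval (P222 + Q222) = ec_add_val E222
  (Some (- 262 / 13, 32 * avar + 8)) (Some (- 366 / 13, 32 * avar + 8)) by [].
have n8 : (8 : Qa) != 0 by exact: (@Qa_natr_neq0 8).
have npq : - 262 / 13 - - 366 / 13 != 0 :> Qa.
  apply: contra_neq n8 => h.
  transitivity ((- 262 / 13 + shift) - (- 366 / 13 + shift)).
    by rewrite eP eQ; ring.
  by rewrite -[RHS]h; move: (- 262 / 13) (- 366 / 13) shift => u v s; ring.
case: (ec_addP P222_on_curve Q222_on_curve) => [/eqP|l m x3 _ [h1 _ _] e1 e2].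
  by rewrite -subr_eq0 (negbTE npq).
have l0 : l = 0.
  by apply: (mulIf npq); rewrite mul0r mulrBr; apply/eqP;
     rewrite subr_eq0; apply/eqP; apply: (addIr m); rewrite -e1.
exists x3; last first.
  by rewrite l0 mul0r add0r; congr (Some (_, - _)); move: e1;
     rewrite l0 mul0r add0r => <-; rewrite bvarE; ring.
transitivity ((- 262 / 13 + - 366 / 13 + x3) - (- 262 / 13 + shift)
  - (- 366 / 13 + shift) + 3 * shift).
  by move: (- 262 / 13) (- 366 / 13) shift => u v s; ring.
by rewrite eP eQ h1 l0 E222_a2E; move: shift bvar => s b; ring.
Qed.

(** Real specializations give no obstruction: the quartic is 64 at l = 0, and at one of the two
    square roots of 8 it is negative for every nonzero b. Degrees in a decide instead: [L ^+ 4]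
    dominates unless [L] is constant, and no constant works. *)
Lemma PQ222_not_double (S : ecpoint E222) : S + S <> P222 + Q222.
Proof.
have [x ex eS] := E222_addPQ.
move=> /(congr1 (@ecval _ E222)); rewrite eS => /E222_double[l [w]].
rewrite ex => -[h1 h2].
have {h1 h2} e : (8 - l ^+ 2) ^+ 2 + 4 * bvar * l ^+ 2 + 16 * bvar * l = 0.
  have h3 : l ^+ 2 = 2 * w + 8 by rewrite -[LHS](subrK (bvar + 8)) -h1; ring.
  have h4 : w ^+ 2 = 8 * bvar + 2 * l * (- (2 * bvar) + l * - bvar) - 2 * w * - bvar.
    by rewrite -h2; ring.
  transitivity (4 * w ^+ 2 + 4 * bvar * l ^+ 2 + 16 * bvar * l).
    by rewrite h3; ring.
  rewrite h4 (_ : 2 * l * (- (2 * bvar) + l * - bvar)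
    = - 4 * bvar * l - 2 * bvar * l ^+ 2).
    by rewrite h3; ring.
  by ring.
have [L eL] : exists L, l = fr L.
  apply: (@Qa_integral [:: - 64%:R; - (16 * bpoly); 16 - 4 * bpoly; 0]).
  rewrite /= !big_ord_recl big_ord0 /= /bump /=.
  transitivity (l ^+ 4 - ((8 - l ^+ 2) ^+ 2 + 4 * bvar * l ^+ 2 + 16 * bvar * l)).
    by rewrite e subr0.
  by rewrite /bvar; ring.
have {e} : fr (L ^+ 4 + (64 + 16 * bpoly * L + (4 * bpoly - 16) * L ^+ 2)) = 0.
  by rewrite -e eL /bvar; ring.
move/eqP; rewrite tofrac_eq0 addr_eq0 => /eqP e.
have [/size1_polyC eL1|sL] := leqP (size L) 1.
  pose c := L`_0.
  have ev (t : rat) : (8 - c ^+ 2) ^+ 2 + 4 * t * (c ^+ 2 + 4 * c) = 0.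
    pose ev : {rmorphism {poly rat} -> rat} := horner_eval ((t - 4) / 16).
    have evL : ev L = c by rewrite /ev /= /horner_eval {1}eL1 hornerC.
    have evb : ev bpoly = t by rewrite /ev /= /horner_eval horner_bpoly; field.
    have e' : ev (L ^+ 4 + (64 + 16 * bpoly * L + (4 * bpoly - 16) * L ^+ 2)) = 0.
      by rewrite e addrC subrr rmorph0.
    by rewrite -[RHS]e' -evL -[t in LHS]evb; ring.
  have ev0 := ev 0; have ev1 := ev 1.
  have h0 : (8 - c ^+ 2) ^+ 2 = 0 by lra.
  have h1 : c * (c + 4) = 0 by lra.
  move/eqP: h1 h0; rewrite mulf_eq0 addr_eq0 => /orP[] /eqP ->; lra.
have L0 : L != 0 by rewrite -size_poly_gt0 ltnW.
have := size_expE 4 L0; rewrite e size_polyN.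
set n := (size L).-1 => es.
have sL' : (size L <= n.+1)%N by rewrite prednK // size_poly_gt0.
have n1 : (1 <= n)%N by rewrite /n; lia.
suff : (size (64 + 16 * bpoly * L + (4 * bpoly - 16) * L ^+ 2)%R
         <= (n * 2).+2)%N.
  by rewrite es; lia.
have sb := size_bpoly; have s16 := size_num_leq 16; have s4 := size_num_leq 4.
apply: size_add_le; first apply: size_add_le.
- exact: leq_trans (size_num_leq _) _.
- apply: (@size_mul_le _ _ 1 n); [|exact: sL'|lia].
  exact: (@size_mul_le _ _ 0 1).
- apply: (@size_mul_le _ _ 1 (n * 2)); [| |lia].
    apply: size_add_le; first exact: (@size_mul_le _ _ 0 1).
    by rewrite size_polyN; apply: leq_trans s16 _.
  exact: size_exp_le sL' _.
Qed.

(** * Ranks and relations *)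

(** For constant w = c, y is integral, so the right-hand side is the square of a polynomial; as a
    quadratic in b its discriminant must vanish. Every other point thus has w transcendental over
    Q. *)
Lemma E222_const_abscissa x y (c : rat) :
  y ^+ 2 = cubic E222 x -> x + shift = fr c%:P -> c ^+ 2 * ((c + 8) * (c - 8)) = 0.
Proof.
rewrite E222_cubicE => e ex; rewrite ex in e; pose k : {poly rat} := c%:P.
rewrite -/k in e.
pose R := 4 * bpoly ^+ 2 + bpoly * (k ^+ 2 + 8 * k) + (k ^+ 3 + 8 * k ^+ 2).
have {}e : y ^+ 2 = fr R.
  by rewrite e /R /bvar; ring.
have [L eL] : exists L, y = fr L.
  apply: (@Qa_integral [:: R; 0]).
  by rewrite /= !big_ord_recl big_ord0 /= /bump /= e; ring.
have {}e : L ^+ 2 = R.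
  apply/eqP; rewrite -tofrac_eq -e eL; apply/eqP; ring.
have [/size2_polyE eL2|sL] := leqP (size L) 2.
  have [p [q ev]] : exists p q : rat, forall t : rat, (p * t + q) ^+ 2 =
      4 * t ^+ 2 + t * (c ^+ 2 + 8 * c) + (c ^+ 3 + 8 * c ^+ 2).
    exists (L`_1 / 16), (L`_0 - L`_1 / 4) => t.
    pose ev : {rmorphism {poly rat} -> rat} := horner_eval ((t - 4) / 16).
    have evL : ev L = L`_1 / 16 * t + (L`_0 - L`_1 / 4).
      by rewrite /ev /= /horner_eval {1}eL2 hornerD hornerM !hornerC hornerX; field.
    have evb : ev bpoly = t by rewrite /ev /= /horner_eval horner_bpoly; field.
    have evk : ev k = c by rewrite /ev /= /horner_eval hornerC.
    by rewrite -evL -rmorphXn e -[in RHS]evb -[in RHS]evk /R; ring.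
  have ev0 := ev 0; have ev1 := ev 1; have evm := ev (-1).
  have p2 : p ^+ 2 = 4 by lra.
  have pq : 2 * p * q = c ^+ 2 + 8 * c by lra.
  have q2 : q ^+ 2 = c ^+ 3 + 8 * c ^+ 2 by lra.
  have : (c ^+ 2 + 8 * c) ^+ 2 = 16 * (c ^+ 3 + 8 * c ^+ 2).
    by rewrite -pq -q2 (_ : 16 = 4 * 4) // -{1}p2; ring.
  by lra.
have L0 : L != 0 by rewrite -size_poly_gt0 (leq_trans _ sL).
have := size_expE 2 L0; rewrite e; set n := (size L).-1 => es.
have n2 : (2 <= n)%N by rewrite /n; lia.
suff : (size R <= 3)%N by rewrite es; lia.
have sk : (size k <= 1)%N by exact: size_polyC_leq1.
have sb := size_bpoly; have s4 := size_num_leq 4; have s8 := size_num_leq 8.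
have sC i (f : rat) : (0 < i)%N -> (size (f%:P)%R <= i)%N.
  exact: leq_trans (size_polyC_leq1 _).
apply: size_add_le; first apply: size_add_le.
- apply: (@size_mul_le _ _ 0 2) => //; exact: (@size_exp_le _ 1).
- apply: (@size_mul_le _ _ 1 0) => //.
  by rewrite /k -polyC_natr -polyCM -polyC_exp -polyCD sC.
- by rewrite /k -polyC_natr -!polyC_exp -polyCM -polyCD sC.
Qed.

Lemma int_parity (m : int) : exists q, m = q + q \/ m = q + q + 1.
Proof.
exists (m %/ 2)%Z; have := divz_eq m 2.
have := @modz_ge0 m 2 isT; have := @ltz_pmod m 2 isT.
by move: (m %/ 2)%Z (m %% 2)%Z => q r; lia.
Qed.

(* Halving the coefficients of a relation, as long as both are even. *)
Lemma independent_mod2 (G : zmodType) (P Q : G) :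
    (forall S : G, S + S = 0 -> S = 0) ->
    (forall S : G, S + S <> P) -> (forall S : G, S + S <> Q) ->
    (forall S : G, S + S <> P + Q) ->
  forall m n : int, P *~ m + Q *~ n = 0 -> m = 0 /\ n = 0.
Proof.
move=> tf nP nQ nPQ m n.
elim: {m n}_.+1 {-2}m {-2}n (ltnSn (`|m| + `|n|)%N) => // k IH m n le_k.
have [q em] := int_parity m; have [r en] := int_parity n.
pose S := P *~ q + Q *~ r.
case: em => em; case: en => en; rewrite em en !mulrzDr ?mulr1z => e.
- have /tf e0 : S + S = 0 by rewrite /S addrACA.
  have [k0|kn] := eqVneq (`|m| + `|n|)%N 0%N; first by lia.
  by have := IH q r; move=> /(_ _ e0); lia.
- move/eqP: e; rewrite addrA addrACA -/S addr_eq0 => /eqP e.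
  by case: (nQ (- S)); rewrite -opprD e opprK.
- move/eqP: e; rewrite addrAC addrACA -/S addr_eq0 => /eqP e.
  by case: (nP (- S)); rewrite -opprD e opprK.
- move/eqP: e; rewrite addrACA (addrACA (P *~ q)) -/S addr_eq0 => /eqP e.
  by case: (nPQ (- S)); rewrite -opprD e opprK.
Qed.

(** Expressing [v] through [g] gives an integer matrix with more rows than columns; a rational
    vector in its left kernel, cleared of denominators, is a relation among the [v]. *)
Lemma z_rank_leq (G : zmodType) (m n : nat) (g : m.-tuple G) (v : n.-tuple G) :
  z_generates g -> z_independent v -> (n <= m)%N.
Proof.
move=> gen indep; rewrite leqNgt; apply/negP => lt_mn.
have [a ea] : exists a : 'I_n -> 'I_m -> int,
    forall i, tnth v i = \sum_(j < m) tnth g j *~ a i j.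
  by case: (fin_all_exists (fun i => gen (tnth v i))) => a ea; exists a.
pose A : 'M[rat]_(n, m) := \matrix_(i, j) (a i j)%:~R.
have ker0 : kermx A != 0.
  rewrite -mxrank_eq0 mxrank_ker subn_eq0 -ltnNge.
  exact: leq_ltn_trans (rank_leq_col _) lt_mn.
pose u := nz_row (kermx A).
have u0 : u != 0 by rewrite nz_row_eq0.
have uA : u *m A = 0 by apply/sub_kermxP; exact: nz_row_sub.
(* The row vector is viewed as a polynomial to get a common denominator [d]. *)
have [q [d d0 eq]] := rat_poly_scale (rVpoly u).
have uE i : u 0 i = (d%:~R)^-1 * (q`_i)%:~R.
  by rewrite -coef_rVpoly_ord eq coefZ coef_map.
have dQ0 : d%:~R != 0 :> rat by rewrite intr_eq0.
have za j : \sum_(i < n) a i j * q`_i = 0.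
  apply/eqP; rewrite -(@intr_eq0 rat) rmorph_sum /=; apply/eqP.
  have /matrixP/(_ 0 j) := uA; rewrite !mxE => uj.
  rewrite -[RHS](mulr0 (d%:~R)) -[in RHS]uj mulr_sumr; apply: eq_bigr => i _.
  by rewrite uE !mxE mulrA mulrA mulfV // mul1r rmorphM mulrC.
have z0 i : (q`_(i : 'I_n)) = 0.
  apply: (indep (fun i => q`_i)) i.
  under eq_bigr => i _ do rewrite ea mulrz_suml.
  rewrite exchange_big big1 // => j _.
  under eq_bigr => i _ do rewrite -mulrzA.
  by rewrite -mulrz_sumr za.
by case/eqP: u0; apply/rowP => i; rewrite uE z0 mulr0 mxE.
Qed.

(** * The norm of a generator of the ideal of a point *)

Section QuadraticMatrix.
Variables (R : comNzRingType) (F : R).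

(* Multiplication by a + b Y on R[Y] / (Y^2 - F), so that \det is the norm. *)
Definition quad (a b : R) : 'M[R]_2 :=
  \matrix_(i, j) if i == j then a else if i == 0 then b * F else b.

Lemma quadD a b c d : quad a b + quad c d = quad (a + c) (b + d).
Proof.
apply/matrixP => i j; rewrite !mxE; case: ifP => // _; case: ifP => // _.
by rewrite mulrDl.
Qed.

Lemma quadN a b : - quad a b = quad (- a) (- b).
Proof.
apply/matrixP => i j; rewrite !mxE; case: ifP => // _; case: ifP => // _.
by rewrite mulNr.
Qed.

Lemma quadM a b c d : quad a b * quad c d = quad (a * c + b * d * F) (a * d + b * c).
Proof.
apply/matrixP => i j; rewrite !mxE !big_ord_recl big_ord0 !mxE /= addr0.
by case: i j => -[|[|]] //= ? [[|[|]] //= ?]; ring.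
Qed.

Lemma quad_scalar a : a%:M = quad a 0.
Proof. by apply/matrixP => i j; rewrite !mxE; case: ifP => //; rewrite mul0r if_same. Qed.

Lemma det_quad a b : \det (quad a b) = a ^+ 2 - b ^+ 2 * F.
Proof.
rewrite (expand_det_row _ 0) !big_ord_recl big_ord0 /cofactor !det_mx11 !mxE /=.
by rewrite /bump /=; ring.
Qed.

End QuadraticMatrix.

Lemma cubic_shift (K : fieldType) (b s : K) :
  'X^3 + (b + 8 + 3 * s)%:P * 'X^2
  + (8 * b + 2 * (b + 8) * s + 3 * s ^+ 2)%:P * 'X
  + (4 * b ^+ 2 + 8 * b * s + (b + 8) * s ^+ 2 + s ^+ 3)%:P =
  ('X + s%:P) ^+ 3 + (b%:P + 8) * ('X + s%:P) ^+ 2 + 8 * b%:P * ('X + s%:P)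
  + 4 * b%:P ^+ 2.
Proof. by ring. Qed.

Lemma detX (R : comNzRingType) n (A : 'M[R]_n.+1) m : \det (A ^+ m) = \det A ^+ m.
Proof. by elim: m => [|m IH]; rewrite ?det1 // !exprS det_mulmx IH. Qed.

(** The sum is [D ^+ m * p(N / D)], a polynomial substitute for [p] when a = N / D. The target may
    be a matrix ring, so commutation with scalars is assumed. *)
Lemma ratio_homogenize (K : fieldType) (T : nzRingType)
    (emb : {rmorphism {poly rat} -> K}) (sigma : {rmorphism K -> T})
    (tau : {rmorphism {poly {poly rat}} -> T}) (N D : {poly {poly rat}})
    (p : {poly rat}) m :
    (forall c : rat, tau c%:P%:P = sigma (emb c%:P)) ->
    (forall c z, sigma c * z = z * sigma c) ->
    tau N = sigma (emb 'X) * tau D -> (size p <= m)%N ->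
  tau (\sum_(i < m) (p`_i)%:P%:P * N ^+ i * D ^+ (m - i))
    = sigma (emb p) * tau D ^+ m.
Proof.
move=> tauC sigmaC tauN le_m.
have -> : emb p = \sum_(i < m) emb (p`_i)%:P * emb 'X ^+ i.
  rewrite -{1}(coefK p) poly_def rmorph_sum /=.
  rewrite -(big_mkord xpredT (fun i => emb (p`_i)%:P * emb 'X ^+ i)).
  rewrite (big_cat_nat (n := size p)) //= [X in _ + X]big1_seq ?addr0.
    rewrite big_mkord; apply: eq_bigr => i _.
    by rewrite -mul_polyC rmorphM rmorphXn.
  move=> i /andP[_]; rewrite mem_index_iota => /andP[hi _].
  by rewrite nth_default // !rmorph0 mul0r.
rewrite !rmorph_sum mulr_suml; apply: eq_bigr => i _.
rewrite !rmorphM !rmorphXn tauC tauN exprMn_comm; last exact: sigmaC.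
rewrite -!mulrA; congr (_ * (_ * _)).
by rewrite -exprD subnKC // ltnW.
Qed.

Section NormOfGenerator.
Variables (K : fieldType) (emb : {rmorphism {poly rat} -> K}) (F : {poly K}).
Variables (b s : K).
Local Notation xi := ('X + s%:P : {poly K}).
Hypothesis F_E :
  F = xi ^+ 3 + (b%:P + 8) * xi ^+ 2 + 8 * b%:P * xi + 4 * b%:P ^+ 2.
Hypothesis b_E : b = 16 * emb 'X + 4.

(* The inner variable of {poly {poly rat}} stands for w = x + s, the outer one
   for v = y - 2 b. *)
Definition const_xi : {rmorphism {poly rat} -> {poly K}} :=
  comp_poly xi \o map_poly (emb \o polyC).

Definition regular_rep : {rmorphism {poly {poly rat}} -> 'M[{poly K}]_2} :=
  horner_mx (quad F (- 2 * b%:P) 1) \o map_poly const_xi.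

Definition eval_at (w v : K) : {rmorphism {poly {poly rat}} -> K} :=
  horner_eval v \o map_poly (horner_eval w \o map_poly (emb \o polyC)).

Lemma const_xiC (c : rat) : const_xi c%:P = (emb c%:P)%:P.
Proof. by rewrite /const_xi /= map_polyC comp_polyC. Qed.

Lemma const_xiX : const_xi 'X = xi.
Proof. by rewrite /const_xi /= map_polyX comp_polyX. Qed.

Lemma regular_repC p : regular_rep p%:P = quad F (const_xi p) 0.
Proof. by rewrite /regular_rep /= map_polyC horner_mx_C (quad_scalar F). Qed.

Lemma regular_repX : regular_rep 'X = quad F (- 2 * b%:P) 1.
Proof. by rewrite /regular_rep /= map_polyX horner_mx_X. Qed.

Lemma eval_atC w v p : eval_at w v p%:P = (map_poly (emb \o polyC) p).[w].
Proof. by rewrite /eval_at /= map_polyC /horner_eval hornerC. Qed.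

Lemma eval_atX w v : eval_at w v 'X = v.
Proof. by rewrite /eval_at /= map_polyX /horner_eval hornerX. Qed.

Lemma eval_atCC w v (c : rat) : eval_at w v c%:P%:P = emb c%:P.
Proof. by rewrite eval_atC map_polyC hornerC. Qed.

Lemma eval_atXC w v : eval_at w v 'X%:P = w.
Proof. by rewrite eval_atC map_polyX hornerX. Qed.

(** Reducing powers of v by the curve equation turns [P] into one function [al + be * Y], from which
    both its matrix and its value at the point are read. *)
Lemma regular_repE x y P : y ^+ 2 = F.[x] ->
  exists al be, regular_rep P = quad F al be /\
    eval_at (x + s) (y - 2 * b) P = al.[x] + be.[x] * y.
Proof.
move=> yF; elim/poly_ind: P => [|P c [al [be [e1 e2]]]].
  exists 0, 0; rewrite !rmorph0 !horner0 mul0r addr0; split=> //.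
  by apply/matrixP => i j; rewrite !mxE mul0r !if_same.
exists (al * (- 2 * b%:P) + be * F + const_xi c), (al + be * (- 2 * b%:P)).
rewrite !rmorphD !rmorphM regular_repX regular_repC e1 e2 quadM quadD; split.
  by congr quad; ring.
rewrite eval_atX eval_atC.
have <- : (const_xi c).[x] = (map_poly (emb \o polyC) c).[x + s].
  by rewrite /const_xi /= horner_comp !hornerE.
move: (const_xi c) => k; rewrite !hornerD !hornerM -yF !hornerN !hornerC.
have -> : (2 : {poly K}).[x] = 2 by rewrite -polyC_natr hornerC.
by ring.
Qed.

(* On the curve b = numer / denom, so a = (b - 4) / 16 = ratio_num / ratio_den. *)
Definition denom : {poly {poly rat}} := 4%:P * 'X - ('X ^+ 2 + 8 * 'X)%:P.
Definition numer : {poly {poly rat}} := ('X ^+ 3 + 8 * 'X ^+ 2)%:P - 'X ^+ 2.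
Definition ratio_den : {poly {poly rat}} := 16%:P * denom.
Definition ratio_num : {poly {poly rat}} := numer - 4%:P * denom.

Lemma regular_rep_denom :
  regular_rep denom = quad F (- (8 * b%:P) - xi ^+ 2 - 8 * xi) 4.
Proof.
rewrite /denom rmorphB rmorphM !regular_repC regular_repX quadM quadN quadD.
have -> : const_xi ('X ^+ 2 + 8 * 'X) = const_xi 'X ^+ 2 + 8 * const_xi 'X by ring.
by rewrite const_xiX rmorph_nat; congr quad; ring.
Qed.

(** All terms in [b] cancel, leaving w^4 - 64 w^2. *)
Lemma norm_denom : (- (8 * b%:P) - xi ^+ 2 - 8 * xi) ^+ 2 - 4 ^+ 2 * F
  = \prod_(r <- [:: 8 - s; - s; - s; - 8 - s]) ('X - r%:P).
Proof. by rewrite F_E !big_cons big_nil; ring. Qed.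

Lemma regular_rep_numer : regular_rep numer = quad F b%:P 0 * regular_rep denom.
Proof.
rewrite regular_rep_denom /numer rmorphB rmorphXn regular_repC regular_repX.
have -> : const_xi ('X ^+ 3 + 8 * 'X ^+ 2)
  = const_xi 'X ^+ 3 + 8 * const_xi 'X ^+ 2 by ring.
rewrite const_xiX [quad _ _ _ ^+ 2]expr2 !quadM quadN quadD F_E.
by congr quad; ring.
Qed.

Lemma regular_rep_ratio :
  regular_rep ratio_num = (emb 'X)%:P%:M * regular_rep ratio_den.
Proof.
rewrite /ratio_num /ratio_den rmorphB !rmorphM regular_rep_numer !regular_repC.
rewrite regular_rep_denom (quad_scalar F) !rmorph_nat b_E !quadM quadN quadD.
by congr quad; ring.
Qed.

Lemma det_ratio_den : \det (regular_rep ratio_den)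
  = (256%:R)%:P * (xi ^+ 2 * (xi + 8) * (xi - 8)).
Proof.
rewrite /ratio_den rmorphM regular_repC regular_rep_denom quadM det_quad F_E.
by rewrite rmorph_nat; ring.
Qed.

Lemma eval_at_ratio x y : y ^+ 2 = F.[x] ->
  eval_at (x + s) (y - 2 * b) ratio_num
  = emb 'X * eval_at (x + s) (y - 2 * b) ratio_den.
Proof.
have -> : F.[x] = (x + s) ^+ 3 + (b + 8) * (x + s) ^+ 2 + 8 * b * (x + s) + 4 * b ^+ 2.
  by rewrite F_E -!polyC_natr !hornerE.
move=> yF; rewrite /ratio_num /ratio_den /denom /numer.
set ev := eval_at _ _.
have -> : ev (('X^3 + 8 * 'X^2)%:P - 'X^2 - 4%:P * (4%:P * 'X - ('X^2 + 8 * 'X)%:P))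
  = ev 'X%:P ^+ 3 + 8 * ev 'X%:P ^+ 2 - ev 'X ^+ 2
    - 4 * (4 * ev 'X - (ev 'X%:P ^+ 2 + 8 * ev 'X%:P)) by ring.
have -> : ev (16%:P * (4%:P * 'X - ('X^2 + 8 * 'X)%:P))
  = 16 * (4 * ev 'X - (ev 'X%:P ^+ 2 + 8 * ev 'X%:P)) by ring.
rewrite /ev eval_atX eval_atXC.
have -> : (y - 2 * b) ^+ 2 = y ^+ 2 - 4 * b * y + 4 * b ^+ 2 by ring.
by rewrite yF b_E; ring.
Qed.

(** The roots of the norm of [denom ^+ m], with multiplicity. *)
Definition small_roots m := flatten (nseq m [:: - s; - s; - 8 - s; 8 - s]).

Lemma small_rootsE m : (xi ^+ 2 * (xi + 8) * (xi - 8)) ^+ m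
  = \prod_(r <- small_roots m) ('X - r%:P).
Proof.
elim: m => [|m IH]; first by rewrite big_nil expr0.
rewrite exprS IH /small_roots /= !big_cons -/(small_roots m) !mulrA.
by congr (_ * _); ring.
Qed.

Lemma mem_small_roots m : {subset small_roots m <= small_roots 1}.
Proof. by move=> r /flattenP[l]; rewrite mem_nseq /= => /andP[_ /eqP ->]. Qed.

(** Let [h] generate the ideal of the point in Q[w, v]. Its norm divides the norms of two lines
    through the point, up to powers of [Z]. The vertical line gives a double root at [x], the other
    a simple one, so the norm of [h] divides a power of [Z] times ['X - x%:P]; it vanishes at [x]
    because [h] vanishes at the point. *)
Lemma norm_generator x y :
    (forall z, exists A B, emb B != 0 /\ z = emb A / emb B) ->
    (2 : K) != 0 -> y != 0 -> y ^+ 2 = F.[x] ->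
    (forall p : {poly rat}, (map_poly (emb \o polyC) p).[x + s] = 0 -> p = 0) ->
    x \notin small_roots 1 ->
  exists al be c rs, [/\ c != 0,
    al ^+ 2 - be ^+ 2 * F = c *: \prod_(r <- x :: rs) ('X - r%:P) &
    {subset rs <= small_roots 1}].
Proof.
move=> frac n2 y0 yF inj_w xsm.
pose ev := eval_at (x + s) (y - 2 * b).
pose rho := regular_rep.
pose Z := xi ^+ 2 * (xi + 8) * (xi - 8).
have [A [B [B0 eA]]] := frac (x + s).
have [C [D [D0 eC]]] := frac (y - 2 * b).
pose Q := B * D; pose A1 := A * D; pose C1 := C * B.
have Q0 : emb Q != 0 by rewrite rmorphM mulf_neq0.
have ex : emb A1 = emb Q * (x + s).
  by rewrite eA /A1 /Q !rmorphM; field.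
have ey : emb C1 = emb Q * (y - 2 * b).
  by rewrite eC /C1 /Q !rmorphM; field.
pose hom m (p : {poly rat}) :=
  \sum_(i < m) (p`_i)%:P%:P * ratio_num ^+ i * ratio_den ^+ (m - i).
have ev_hom m (p : {poly rat}) : (size p <= m)%N -> ev (hom m p) = emb p * ev ratio_den ^+ m.
  apply: (@ratio_homogenize _ _ emb idfun ev) => [c|c z|].
  - exact: eval_atCC.
  - exact: mulrC.
  - exact: eval_at_ratio.
have scalar_comm (c : {poly K}) (M : 'M_2) : c%:M * M = M * c%:M.
  by rewrite [LHS]mul_scalar_mx [RHS]mul_mx_scalar.
have rho_hom m (p : {poly rat}) : (size p <= m)%N ->
    rho (hom m p) = (emb p)%:P%:M * rho ratio_den ^+ m.
  apply: (@ratio_homogenize _ _ emb (@scalar_mx _ _ \o polyC) rho) => [c|c z|].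
  - by rewrite /rho regular_repC const_xiC /= (quad_scalar F).
  - exact: scalar_comm.
  - exact: regular_rep_ratio.
(* g stands for the line u (w - w0) + v (Y - y) = 0 through the given point. *)
have line (u v : rat) : exists g, ev g = 0 /\
    exists k n, k != 0 /\ \det (rho g) = k *: Z ^+ n *
     \det (quad F ((emb u%:P)%:P * ('X - x%:P)
                  - (emb v%:P)%:P * y%:P) (emb v%:P)%:P).
  pose R := u *: A1 + v *: C1.
  pose m := maxn (size Q) (size R).
  have hQ : (size Q <= m)%N by rewrite leq_maxl.
  have hR : (size R <= m)%N by rewrite leq_maxr.
  have eR : emb R = emb Q * (emb u%:P * (x + s) + emb v%:P * (y - 2 * b)).
    transitivity (emb u%:P * emb A1 + emb v%:P * emb C1).
      by rewrite /R -!mul_polyC rmorphD (rmorphM emb u%:P) (rmorphM emb v%:P).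
    by rewrite ex ey; ring.
  (* On the curve [g] is [emb Q * ratio_den ^+ m] times the line: both the common denominator of the
     coordinates and the dependence on a have been cleared. *)
  pose g := hom m Q * (u%:P%:P * 'X%:P + v%:P%:P * 'X) - hom m R.
  exists g; split.
    have evL : ev (u%:P%:P * 'X%:P + v%:P%:P * 'X)
        = emb u%:P * (x + s) + emb v%:P * (y - 2 * b).
      rewrite rmorphD (rmorphM ev u%:P%:P) (rmorphM ev v%:P%:P).
      by rewrite [ev _]eval_atCC [ev _]eval_atXC [ev v%:P%:P]eval_atCC [ev _]eval_atX.
    rewrite /g rmorphB rmorphM ev_hom // ev_hom // evL eR.
    by move: (ev ratio_den ^+ m) (emb _) (emb _) (emb _) => d0 q u0 v0; ring.
  exists ((256%:R) ^+ m * emb Q ^+ 2), m; split.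
    rewrite mulf_neq0 ?expf_neq0 //.
    by rewrite (_ : 256%:R = 2 ^+ 8) ?expf_neq0 // -natrX.
  have -> : rho g = rho ratio_den ^+ m * (emb Q)%:P%:M * quad F
      ((emb u%:P)%:P * ('X - x%:P) - (emb v%:P)%:P * y%:P) (emb v%:P)%:P.
    have rhoL : rho (u%:P%:P * 'X%:P + v%:P%:P * 'X) = quad F
        ((emb u%:P)%:P * xi + (emb v%:P)%:P * (- 2 * b%:P)) (emb v%:P)%:P.
      rewrite rmorphD (rmorphM rho u%:P%:P) (rmorphM rho v%:P%:P) /rho.
      rewrite !regular_repC regular_repX !const_xiC const_xiX !quadM quadD.
      by congr quad; ring.
    rewrite /g rmorphB rmorphM rho_hom // rho_hom // rhoL eR.
    move: (rho ratio_den ^+ m) => d0.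
    rewrite [X in X * _ - _]scalar_comm [X in _ - X]scalar_comm -!mulrA -mulrBr.
    congr (_ * _); rewrite !(quad_scalar F) !quadM quadN quadD.
    move: (emb _) (emb _) (emb _) => q u0 v0.
    by congr quad; ring.
  rewrite !det_mulmx detX det_ratio_den det_scalar exprMn -mul_polyC.
  rewrite -/Z; move: (Z ^+ m) (\det _) (256%:R) (emb Q) => z d0 c q.
  by rewrite polyCM !polyC_exp (mulrAC _ z).
(* The slope is chosen so that the second line is not tangent to the curve at the point. *)
have [l hl] : exists l : rat, F^`().[x] + 2 * emb l%:P * y != 0.
  have [F0|nF] := eqVneq F^`().[x] 0.
    by exists 1; rewrite F0 add0r !rmorph1 mulr1 mulf_neq0.
  by exists 0; rewrite !rmorph0 mulr0 mul0r addr0.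
have [g1 [ev1 [k1 [n1 [k10 d1]]]]] := line 1 0.
have [g2 [ev2 [k2 [n3 [k20 d2]]]]] := line l 1.
pose X1 := 'X - x%:P.
pose L := (emb l%:P)%:P * X1 - y%:P.
have {}d1 : \det (rho g1) = k1 *: Z ^+ n1 * (X1 * X1).
  by rewrite d1 det_quad !rmorph1 !rmorph0 mul1r mul0r subr0 expr0n mul0r subr0 expr2.
have {}d2 : \det (rho g2) = k2 *: Z ^+ n3 * (L ^+ 2 - F).
  by rewrite d2 det_quad !rmorph1 mul1r expr1n mul1r.
have [q eq] : exists q, L ^+ 2 - F = q * X1.
  apply/factor_theorem; rewrite /root /L /X1.
  rewrite hornerD hornerN -yF horner_exp hornerD hornerM hornerXsubC subrr mulr0.
  by rewrite hornerN hornerC add0r sqrrN subrr.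
have qx : ~~ root q x.
  apply: contra hl => /eqP qx0; apply/eqP.
  have dq : (q * X1)^`().[x] = 0.
    by rewrite derivM hornerD !hornerM hornerXsubC subrr mulr0 qx0 mul0r addr0.
  have dL : L^`() = (emb l%:P)%:P.
    by rewrite /L derivB derivM !derivC mul0r add0r derivXsubC mulr1 subr0.
  have Lx : L.[x] = - y.
    by rewrite /L hornerD hornerM hornerXsubC subrr mulr0 add0r hornerN hornerC.
  move: dq; rewrite -eq derivB expr2 derivM dL hornerD hornerN hornerD !hornerM.
  rewrite Lx hornerC => dq; apply: oppr_inj; rewrite oppr0 -dq; ring.
have X10 : X1 != 0 by rewrite polyXsubC_eq0.
have Z0 : Z != 0.
  have nz (c : K) : 'X + c%:P != 0 by rewrite -[c]opprK polyCN polyXsubC_eq0.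
  by rewrite /Z -addrA -addrA -!polyC_natr -polyCN -!polyCD !mulf_neq0 ?expf_neq0 ?nz.
have dg10 : \det (rho g1) != 0.
  by rewrite d1 -scalerAl scaler_eq0 (negbTE k10) !mulf_neq0 ?expf_neq0.
have g10 : g1 != 0.
  apply: contra_neq dg10 => ->; rewrite rmorph0 -(scale0r 1) detZ expr0n mul0r //.
have [h [evh h_dvd]] : exists h, ev h = 0 /\ forall g, ev g = 0 -> exists q, g = q * h.
  apply: kernel_principal; last by exists g1.
  by move=> p; rewrite /ev eval_atC; exact: inj_w.
pose N := \det (rho h).
have N_dvd g : ev g = 0 -> N %| \det (rho g).
  by move=> /h_dvd[g' ->]; rewrite rmorphM det_mulmx dvdp_mull.
pose n := maxn n1 n3.
have Zn m : (m <= n)%N -> Z ^+ m %| Z ^+ n by exact: dvdp_exp2l.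
have N1 : N %| Z ^+ n * X1 * X1.
  apply: dvdp_trans (N_dvd _ ev1) _; rewrite d1 -scalerAl dvdpZl //.
  by rewrite -mulrA dvdp_mul // Zn // leq_maxl.
have N2 : N %| Z ^+ n * X1 * q.
  apply: dvdp_trans (N_dvd _ ev2) _; rewrite d2 -scalerAl dvdpZl // eq.
  by rewrite [q * _]mulrC -mulrA dvdp_mul // Zn // leq_maxr.
have N3 : N %| Z ^+ n * X1.
  have : N %| gcdp (Z ^+ n * X1 * X1) (Z ^+ n * X1 * q) by rewrite dvdp_gcd N1 N2.
  rewrite (eqp_dvdr _ (gcdp_mul2l _ _ _)).
  have gX : gcdp X1 q %= 1.
    by rewrite -size_poly_eq1 -[_ == _]/(coprimep X1 q) coprimep_sym coprimep_XsubC.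
  by rewrite (eqp_dvdr N (eqp_mull (Z ^+ n * X1) gX)) mulr1.
have N0 : N != 0.
  by apply: contraNneq dg10 => N0; have := N_dvd _ ev1; rewrite N0 dvd0p.
have [al [be [rE evE]]] := regular_repE h yF.
have NE : N = al ^+ 2 - be ^+ 2 * F by rewrite /N /rho rE det_quad.
have Nx : root N x.
  rewrite /root NE hornerD horner_exp hornerN hornerM horner_exp -yF.
  move: evE; rewrite -/ev evh => /esym/eqP; rewrite addr_eq0 => /eqP ->.
  by rewrite sqrrN exprMn subrr.
have : N %| \prod_(r <- x :: small_roots n) ('X - r%:P).
  by rewrite big_cons mulrC -small_rootsE.
case/dvdp_prod_XsubC => msk Nmsk.
have sub : {subset mask (behead msk) (small_roots n) <= small_roots 1}.
  by move=> r /mem_mask; exact: mem_small_roots.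
have rx : root (\prod_(r <- mask msk (x :: small_roots n)) ('X - r%:P)) x.
  by rewrite -(eqp_root Nmsk).
(* The first bit of the mask must select [x]; otherwise the root [x] of [N] would be a small
   root. *)
case: msk Nmsk sub rx => [|[|] msk] /= Nmsk sub rx.
- by rewrite big_nil (negbTE (root1 _)) in rx.
- have [[c1 c2] /= /andP[c10 c20] e12] := eqpP _ _ Nmsk.
  exists al, be, (c1^-1 * c2), (mask msk (small_roots n)); split=> //.
    by rewrite mulf_neq0 ?invr_eq0.
  by rewrite -NE -scalerA -e12 scalerA mulVf // scale1r.
- by move: rx; rewrite root_prod_XsubC => /sub; rewrite (negbTE xsm).
Qed.
End NormOfGenerator.

Lemma cubicp_E222E : cubicp E222 =
  ('X + shift%:P) ^+ 3 + (bvar%:P + 8) * ('X + shift%:P) ^+ 2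
  + 8 * bvar%:P * ('X + shift%:P) + 4 * bvar%:P ^+ 2.
Proof.
rewrite /cubicp E222_a2E E222_a4E E222_a6E; exact: cubic_shift.
Qed.

(** * Generation *)

Section Span.
Variables (G : zmodType) (P Q : G).

Definition in_span2 (g : G) : Prop := exists m n : int, g = P *~ m + Q *~ n.

Lemma in_span2_0 : in_span2 0.
Proof. by exists 0, 0; rewrite !mulr0z addr0. Qed.

Lemma in_span2D g h : in_span2 g -> in_span2 h -> in_span2 (g + h).
Proof.
move=> [m [n ->]] [m' [n' ->]]; exists (m + m'), (n + n').
by rewrite !mulrzDr addrACA.
Qed.

Lemma in_span2N g : in_span2 g -> in_span2 (- g).
Proof. by move=> [m [n ->]]; exists (- m), (- n); rewrite !mulrNz opprD. Qed.

Lemma in_span2_l : in_span2 P.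
Proof. by exists 1, 0; rewrite mulr1z mulr0z addr0. Qed.

Lemma in_span2_r : in_span2 Q.
Proof. by exists 0, 1; rewrite mulr1z mulr0z add0r. Qed.

End Span.

Local Notation in_PQ := (in_span2 P222 Q222).

Lemma abscissa_span (S T : ecpoint E222) x :
  abscissa S = Some x -> abscissa T = Some x -> in_PQ S -> in_PQ T.
Proof.
by move=> hS hT inS; have [->|->] := abscissa_eq hT hS; last exact: in_span2N.
Qed.

(** The point over [x] in the list is minus the sum of the others, each of which is determined up to
    sign by its abscissa. *)
Lemma zeros_span (ps : seq (ecpoint E222)) x (rs : seq Qa) (T : ecpoint E222) :
    perm_eq (map (@abscissa _ _) ps) (map Some (x :: rs)) ->
    \sum_(p <- ps) p = 0 -> abscissa T = Some x ->
    (forall r, r \in rs -> exists2 S, abscissa S = Some r & in_PQ S) ->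
  in_PQ T.
Proof.
move=> hps sps hT hrs.
have /mapP[p0 p0in /esym ap0] : Some x \in map (@abscissa _ _) ps.
  by rewrite (perm_mem hps) inE eqxx.
have hps' : perm_eq (map (@abscissa _ _) (rem p0 ps)) (map Some rs).
  have := perm_map (@abscissa _ _) (perm_to_rem p0in).
  by rewrite perm_sym => /perm_trans/(_ hps); rewrite /= ap0 perm_cons.
apply: (abscissa_span ap0 hT).
have -> : p0 = - \sum_(p <- rem p0 ps) p.
  apply/eqP; rewrite -addr_eq0 -[X in _ == X]sps; apply/eqP/esym.
  exact: (@big_rem _ _ _ _ ps p0 predT id p0in).
apply: in_span2N; rewrite big_seq; elim/big_rec: _ => [|p S pin inS].
  exact: in_span2_0.
apply: in_span2D inS.
have : abscissa p \in map Some rs by rewrite -(perm_mem hps') map_f.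
by case/mapP => r /hrs[R aR inR] ap; apply: abscissa_span aR ap inR.
Qed.

(** At w = 8 the cubic is 4 b^2 + 128 b + 1024, a square. This is the zero of [denom] left besides
    P, counted twice, and Q. *)
Lemma R222_on_curve : on_curve E222 (Some (8 - shift, 2 * bvar + 32)).
Proof.
rewrite /on_curve E222_cubicE subrK.
by apply/eqP; move: bvar => b; ring.
Qed.

Definition R222 : ecpoint E222 := EcPoint R222_on_curve.

Lemma abscissa_P222 : abscissa P222 = Some (- shift).
Proof. by rewrite /abscissa /=; congr Some; apply/eqP; rewrite -addr_eq0 (proj1 shift_eqs). Qed.

Lemma abscissa_Q222 : abscissa Q222 = Some (- 8 - shift).
Proof.
rewrite /abscissa /=; congr Some; apply: (addIr shift).
by rewrite (proj2 shift_eqs) subrK.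
Qed.

(* The zeros of 4 Y - (w^2 + 8 w + 8 b) are P twice, Q and R. *)
Lemma R222_span : in_PQ R222.
Proof.
have n0 := E222_cubic_neq0.
pose xi : {poly Qa} := 'X + shift%:P.
have [] := sum_zeros n0 (rs := [:: 8 - shift; - shift; - shift; - 8 - shift])
  (al := - (8 * bvar%:P) - xi ^+ 2 - 8 * xi) (be := 4) (oner_neq0 _).
- by rewrite scale1r; exact: norm_denom cubicp_E222E.
- move=> r; rewrite !inE => /or4P[] /eqP ->.
  + by exists R222.
  + by exists P222; exact: abscissa_P222.
  + by exists P222; exact: abscissa_P222.
  + by exists Q222; exact: abscissa_Q222.
move=> ps hps sps; apply: (zeros_span hps sps) => //.
move=> r; rewrite !inE => /or3P[] /eqP ->.
- by exists P222; [exact: abscissa_P222 | exact: in_span2_l].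
- by exists P222; [exact: abscissa_P222 | exact: in_span2_l].
- by exists Q222; [exact: abscissa_Q222 | exact: in_span2_r].
Qed.

Lemma small_span r : r \in small_roots shift 1 ->
  exists2 S, abscissa S = Some r & in_PQ S.
Proof.
rewrite !inE => /or4P[] /eqP ->.
- by exists P222; [exact: abscissa_P222 | exact: in_span2_l].
- by exists P222; [exact: abscissa_P222 | exact: in_span2_l].
- by exists Q222; [exact: abscissa_Q222 | exact: in_span2_r].
- by exists R222; [|exact: R222_span].
Qed.

Lemma E222_span (S : ecpoint E222) : in_PQ S.
Proof.
have n0 := E222_cubic_neq0.
case eS : (ecval S) => [[x y]|]; last first.
  rewrite (_ : S = 0); first exact: in_span2_0.
  exact: val_inj.
have aS : abscissa S = Some x by rewrite /abscissa eS.
have [/small_span[T aT inT]|xsm] := boolP (x \in small_roots shift 1).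
  exact: abscissa_span aT aS inT.
have yE : y ^+ 2 = cubic E222 x.
  by apply/eqP; have := valP S; rewrite [val S]eS.
have y0 : y != 0 by rewrite -sqrf_eq0 yE.
have frac (z : Qa) : exists A B, fr B != 0 /\ z = fr A / fr B.
  by have [A [B [B0 _ ->]]] := Qa_fracP z; exists A, B; rewrite tofrac_eq0.
(* A nonzero [p] would make w constant, and then [x] would be a small root. *)
have inj_w (p : {poly rat}) : (map_poly (fr \o polyC) p).[x + shift] = 0 -> p = 0.
  move=> p0; apply/eqP; apply: contraT => /Qa_transcendental/(_ p0)[c ec].
  have /eqP := E222_const_abscissa yE ec.
  rewrite mulf_eq0 expf_eq0 mulf_eq0 /= addr_eq0 subr_eq0 => hc.
  have ex : x = fr c%:P - shift by rewrite -ec addrK.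
  case/negP: xsm; rewrite !inE ex.
  case/or3P: hc => /eqP ->.
  - by rewrite !rmorph0 sub0r eqxx.
  - by rewrite polyCN polyC_natr rmorphN rmorph_nat eqxx !orbT.
  - by rewrite polyC_natr rmorph_nat eqxx !orbT.
have n2 : (2 : Qa) != 0 by exact: (@Qa_natr_neq0 2).
have yF : y ^+ 2 = (cubicp E222).[x] by rewrite horner_cubicp.
have [al [be [c [rs [c0 hN hrs]]]]] :=
  norm_generator cubicp_E222E bvarE frac n2 y0 yF inj_w xsm.
(* Every root of the norm needs a point over it: [S] over [x], and a point already known to lie in
   the span over each other root. *)
have [] := sum_zeros n0 c0 hN.
  move=> r; rewrite inE => /predU1P[->|/hrs/small_span[T aT _]]; first by exists S.
  by exists T.
move=> ps hps sps; apply: zeros_span hps sps aS _ => r /hrs; exact: small_span.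
Qed.

Lemma E222_generates : z_generates [tuple P222; Q222].
Proof.
move=> S; have [m [n ->]] := E222_span S.
exists (fun i : 'I_2 => if i == 0 then m else n).
by rewrite !big_ord_recl big_ord0 addr0 !(tnth_nth 0).
Qed.

Lemma E222_independent : z_independent [tuple P222; Q222].
Proof.
have tf (S : ecpoint E222) : S + S = 0 -> S = 0.
  case: S => [[[x y]|] hS] e; last exact: val_inj.
  have y0 : y != 0.
    by rewrite -sqrf_eq0 (on_curveE hS) E222_cubic_neq0.
  have hS' := hS.
  have := congr1 (@ecval _ E222) e.
  change (ec_add_val E222 (Some (x, y)) (Some (x, y)) = None -> EcPoint hS = 0).
  case: (ec_addP hS hS') => // _ /eqP; rewrite -addr_eq0 -mulr2n -mulr_natl.
  by rewrite mulf_eq0 (negbTE y0) (negbTE (ec_two_neq0 E222)).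
move=> c; rewrite !big_ord_recl big_ord0 addr0 !(tnth_nth 0) => e.
have [c0 c1] := independent_mod2 tf P222_not_double Q222_not_double
  PQ222_not_double e.
move=> i; case: (unliftP 0 i) => [j|] -> //.
by rewrite [j]ord1.
Qed.

Theorem theorem3p3 :
  has_z_rank (ecpoint E222) 2 /\
  z_independent [tuple P222; Q222] /\
  z_generates [tuple P222; Q222].
Proof.
have gen := E222_generates; have indep := E222_independent.
split; [split | by split]; first by exists [tuple P222; Q222].
by move=> n v; exact: z_rank_leq.
Qed.
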